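(* Let $(X,\mathcal{X},\mu,T)$ be a measure preserving system. Then the following are equivalent: (i) The system has an under-recurrent function. (ii) The system has a strictly under-recurrent function. (iii) The system has a Lebesgue component. (iv) For every non-negative $\phi\in L^1(m_{\mathbb{T}})$ there exists $g\in L^2(\mu)$ such that $$\int g\,d\mu=0\quad\text{and}\quad\int g\cdot T^ng\,d\mu=\widehat{\phi}(n)\ \text{ for every } n\in\mathbb{N}.$$
   Context: A measure preserving system (or simply a system) is a quadruple $(X,\mathcal{X},\mu,T)$ where $(X,\mathcal{X},\mu)$ is a probability space and $T\colon X\to X$ is a measure preserving transformation. Throughout, all functions are assumed to be real valued, and $Tf$ denotes the composition $f\circ T$ (so $T^nf=f\circ T^n$). $\mathbb{N}=\{1,2,\ldots\}$, $\mathbb{T}=\mathbb{R}/\mathbb{Z}$, $m_{\mathbb{T}}$ is the Lebesgue (Haar probability) measure on $\mathbb{T}$, and $\widehat{\phi}(n)=\int\phi(t)e^{2\pi int}\,dm_{\mathbb{T}}(t)$. A function $f\in L^2(\mu)$ is under-recurrent if it is non-constant and $\int f\cdot T^nf\,d\mu\leq\left(\int f\,d\mu\right)^2$ for every $n\in\mathbb{N}$; it is strictly under-recurrent if it is non-constant and the inequality is strict for every $n\in\mathbb{N}$. The system has a Lebesgue component if there exists a function $f\in L^2(\mu)$ with spectral measure equal to the Lebesgue measure on $\mathbb{T}$, that is, satisfying $\|f\|_{L^2(\mu)}=1$ and $\int f\cdot T^nf\,d\mu=0$ for every $n\in\mathbb{N}$.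
   Formalization: In (iv), φ ranges only over non-negative φ in L¹ whose coefficients φ^(n), n in N, are all real (φ even a.e.); since all functions g are real valued, (iv) as written fails for every system, e.g. for φ = 1 + sin(2πt). *)

(* Defs.v *)
From HB Require Import structures.
From mathcomp Require Import all_boot all_order all_algebra.
From mathcomp Require Import complex.
From mathcomp Require Import all_classical all_reals all_analysis.

Set Implicit Arguments.
Unset Strict Implicit.
Unset Printing Implicit Defensive.

Import Order.TTheory GRing.Theory Num.Theory.
Import numFieldNormedType.Exports.

Local Open Scope classical_set_scope.
Local Open Scope ring_scope.
Local Open Scope complex_scope.

Section systems.
Context {d : measure_display} {X : measurableType d} {R : realType}.
Implicit Types (mu : probability X R) (T : X -> X) (f : X -> R).

Definition measure_preserving mu T : Prop :=
  measurable_fun [set: X] T /\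
  forall A : set X, measurable A -> mu (T @^-1` A) = mu A.

Definition correlation mu T f (n : nat) : R :=
  \int[mu]_x (f x * f (iter n T x)).

(* Elements of L^2 are represented by functions, so that being constant means
   being almost everywhere equal to a constant. *)
Definition nonconstant mu f : Prop :=
  ~ exists c : R, ae_eq mu [set: X] f (cst c).

Definition under_recurrent mu T f : Prop :=
  [/\ f \in Lfun mu 2%:E, nonconstant mu f &
   forall n : nat, (0 < n)%N ->
     correlation mu T f n <= (\int[mu]_x f x) ^+ 2].

Definition strictly_under_recurrent mu T f : Prop :=
  [/\ f \in Lfun mu 2%:E, nonconstant mu f &
   forall n : nat, (0 < n)%N ->
     correlation mu T f n < (\int[mu]_x f x) ^+ 2].

Definition has_Lebesgue_component mu T : Prop :=
  exists f : X -> R,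
    [/\ f \in Lfun mu 2%:E, Lnorm mu 2%:E (EFin \o f) = 1%E &
     forall n : nat, (0 < n)%N -> correlation mu T f n = 0].

End systems.

(* The torus R/Z is represented by its fundamental domain [0, 1[, and its Haar
   probability measure by the restriction of the Lebesgue measure to it; the
   values of a function outside [0, 1[ are irrelevant. *)
Section torus.
Context {R : realType}.
Implicit Types (phi : R -> R) (t : R).

Definition torus : set R := `[0, 1[%classic.

Definition nonneg_L1_torus phi : Prop :=
  lebesgue_measure.-integrable torus (EFin \o phi) /\
  {ae lebesgue_measure, forall t, torus t -> 0 <= phi t}.

Definition torus_integral (F : R -> R[i]) : R[i] :=
  (\int[lebesgue_measure]_(t in torus) complex.Re (F t)) +i*
  (\int[lebesgue_measure]_(t in torus) complex.Im (F t)).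

(* exp(i t) *)
Definition expi t : R[i] := cos t +i* sin t.

Definition fourier_coef phi (n : nat) : R[i] :=
  torus_integral (fun t => (phi t)%:C * expi (2 * pi * n%:R * t)).

End torus.

(* All functions on X are real valued, so the correlations of g are real
   numbers: the prescribed Fourier coefficients have to be real, which amounts
   to phi being even up to a null set.  Without this condition the property
   would hold for no system at all. *)
Definition realizes_nonneg_densities {d : measure_display}
    {X : measurableType d} {R : realType}
    (mu : probability X R) (T : X -> X) : Prop :=
  forall phi : R -> R, nonneg_L1_torus phi ->
  (forall n : nat, (0 < n)%N -> fourier_coef phi n \is Num.real) ->
  exists g : X -> R,
    [/\ g \in Lfun mu 2%:E, \int[mu]_x g x = 0 &
     forall n : nat, (0 < n)%N ->
       (correlation mu T g n)%:C = fourier_coef phi n].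

(* Main.v *)
(* Write [g] for the correlations of a function [f]; the map [p |-> p(T) f]
   identifies polynomials, normed by the Toeplitz form of [g], with a subspace of
   L^2. The innovation of [f] is its component orthogonal to the closed span of
   the [T^n f], [n >= 1]. It is orthogonal to all its own iterates, so it yields a
   Lebesgue component as soon as it is nonzero, which for nonpositive
   correlations follows from positivity of the Toeplitz form. Conversely, if the
   iterates of [f] are orthonormal, it suffices to find a square summable sequence
   with prescribed autocorrelations. For strict under-recurrence an explicit
   geometric sequence will do. For a density [phi], the correlation of index [0]
   is free, so [phi] may be replaced by [1 + phi]. Its Toeplitz form dominates the
   standard one, and absolute continuity of [phi] makes it closable: an element
   of the remote future of the associated stationary process vanishes in
   L^2(dt), hence in L^2((1 + phi) dt). The process is therefore the orthogonal
   sum of the shifted innovations, and the coefficients of its Wold decomposition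
   form the desired sequence. *)

Require Import Defs.
From HB Require Import structures.
From mathcomp Require Import all_boot all_order all_algebra.
From mathcomp Require Import complex.
From mathcomp Require Import all_classical all_reals all_analysis.
From mathcomp Require Import measurable_realfun ring lra zify.

Set Implicit Arguments.
Unset Strict Implicit.
Unset Printing Implicit Defensive.

Import Order.TTheory GRing.Theory Num.Theory.
Import numFieldNormedType.Exports.

Local Open Scope classical_set_scope.
Local Open Scope ring_scope.

(** * Toeplitz forms on polynomials *)

Section toeplitz.
Context {R : realType}.
Implicit Types (g : nat -> R) (p q r : {poly R}).

(* With truncated subtraction, [(i - j) + (j - i)] is the distance [|i - j|]. *)
Definition toeplitz g p q : R :=
  \sum_(i < size p) \sum_(j < size q) p`_i * q`_j * g ((i - j) + (j - i))%N.

Lemma toeplitzE n m g p q : (size p <= n)%N -> (size q <= m)%N ->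
  toeplitz g p q =
  \sum_(i < n) \sum_(j < m) p`_i * q`_j * g ((i - j) + (j - i))%N.
Proof.
move=> pn qm; rewrite /toeplitz (big_ord_widen _ (fun i : nat =>
  \sum_(j < size q) p`_i * q`_j * g ((i - j) + (j - i))%N) pn) big_mkcond.
apply: eq_bigr => i _; case: ltnP => ip; last first.
  by rewrite big1// => j _; rewrite (nth_default 0 ip) !mul0r.
rewrite (big_ord_widen _ (fun j : nat =>
  p`_i * q`_j * g ((i - j) + (j - i))%N) qm) big_mkcond.
apply: eq_bigr => j _; case: ltnP => // jq.
by rewrite (nth_default 0 jq) mulr0 mul0r.
Qed.

Lemma toeplitzC g p q : toeplitz g p q = toeplitz g q p.
Proof.
rewrite /toeplitz exchange_big; apply: eq_bigr => i _; apply: eq_bigr => j _.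
by rewrite addnC (mulrC p`__).
Qed.

Lemma toeplitz_linear g a p q r :
  toeplitz g (a *: p + q) r = a * toeplitz g p r + toeplitz g q r.
Proof.
set n := maxn (size p) (size q).
have sp : (size p <= n)%N by rewrite leq_maxl.
have sq : (size q <= n)%N by rewrite leq_maxr.
have sr : (size (a *: p + q)%R <= n)%N.
  rewrite (leq_trans (size_polyD _ _))// geq_max sq andbT.
  by rewrite (leq_trans (size_scale_leq _ _)).
rewrite !(toeplitzE g (n := n) (m := size r))// mulr_sumr -big_split/=.
apply: eq_bigr => i _; rewrite mulr_sumr -big_split/=; apply: eq_bigr => j _.
by rewrite coefD coefZ; ring.
Qed.

Lemma toeplitz0l g r : toeplitz g 0 r = 0.
Proof. by have := toeplitz_linear g 1 0 0 r; rewrite scaler0 addr0; lra. Qed.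

Lemma toeplitzDl g p q r :
  toeplitz g (p + q) r = toeplitz g p r + toeplitz g q r.
Proof. by rewrite -{1}(scale1r p) toeplitz_linear mul1r. Qed.

Lemma toeplitzZl g a p r : toeplitz g (a *: p) r = a * toeplitz g p r.
Proof. by rewrite -(addr0 (a *: p)) toeplitz_linear toeplitz0l addr0. Qed.

Lemma toeplitzNl g p r : toeplitz g (- p) r = - toeplitz g p r.
Proof. by rewrite -scaleN1r toeplitzZl mulN1r. Qed.

Lemma toeplitz_suml g r n (F : 'I_n -> {poly R}) :
  toeplitz g (\sum_i F i) r = \sum_i toeplitz g (F i) r.
Proof.
by apply: (big_morph (fun p => toeplitz g p r)); [move=> p q; exact: toeplitzDl|exact: toeplitz0l].
Qed.

Lemma toeplitzDr g p q r :
  toeplitz g r (p + q) = toeplitz g r p + toeplitz g r q.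
Proof. by rewrite toeplitzC toeplitzDl !(toeplitzC g r). Qed.

Lemma toeplitzNr g p r : toeplitz g r (- p) = - toeplitz g r p.
Proof. by rewrite toeplitzC toeplitzNl (toeplitzC g r). Qed.

Lemma toeplitzZr g a p r : toeplitz g r (a *: p) = a * toeplitz g r p.
Proof. by rewrite toeplitzC toeplitzZl (toeplitzC g r). Qed.

Lemma toeplitz_sumr g r n (F : 'I_n -> {poly R}) :
  toeplitz g r (\sum_i F i) = \sum_i toeplitz g r (F i).
Proof.
by rewrite toeplitzC toeplitz_suml; under eq_bigr do rewrite toeplitzC.
Qed.

Definition toeplitz_lin := (toeplitzDl, toeplitzDr, toeplitzNl, toeplitzNr,
  toeplitzZl, toeplitzZr).

(** Multiplication by ['X] moves both indices by one and keeps their distance, so the shift is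
    isometric. All the stationarity used below comes from here. *)
Lemma toeplitzX g p q : toeplitz g ('X * p) ('X * q) = toeplitz g p q.
Proof.
have sX (r : {poly R}) : (size ('X * r)%R <= (size r).+1)%N.
  by rewrite (leq_trans (size_polyMleq _ _))// size_polyX.
rewrite (toeplitzE g (sX p) (sX q)) big_ord_recl big1 ?add0r; last first.
  by move=> j _; rewrite coefXM !mul0r.
apply: eq_bigr => i _; rewrite big_ord_recl !coefXM/= mulr0 mul0r add0r.
by apply: eq_bigr => j _; rewrite !coefXM/= !subSS.
Qed.

Lemma toeplitzXn g n p q : toeplitz g ('X^n * p) ('X^n * q) = toeplitz g p q.
Proof.
elim: n => [|n IH]; first by rewrite expr0 !mul1r.
by rewrite exprS -!mulrA toeplitzX.
Qed.

Lemma toeplitz_monom g i j :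
  toeplitz g 'X^i 'X^j = g ((i - j) + (j - i))%N.
Proof.
rewrite /toeplitz !size_polyXn big_ord_recr big1 ?add0r => [|k _]; last first.
  by rewrite big1// => l _; rewrite (_ : 'X^i`_k = 0) ?mul0r// coefXn ltn_eqF.
rewrite big_ord_recr big1 ?add0r => [|l _]; last first.
  by rewrite (_ : 'X^j`_l = 0) ?mulr0 ?mul0r// coefXn ltn_eqF.
by rewrite /= !add0r !coefXn !eqxx !mul1r.
Qed.

Lemma toeplitz1Xn g n : toeplitz g 1 'X^n = g n.
Proof. by have := toeplitz_monom g 0 n; rewrite expr0 sub0n subn0. Qed.

(** The correlations of an orthonormal sequence of iterates, or the Fourier coefficients of the
    constant density 1. *)
Definition kdelta (n : nat) : R := (n == 0%N)%:R.

Lemma kdelta_dist (i j : nat) : kdelta ((i - j) + (j - i)) = (i == j)%:R.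
Proof. by rewrite /kdelta addn_eq0 !subn_eq0 -eqn_leq. Qed.

Lemma toeplitz_kdelta n p q : (size p <= n)%N ->
  toeplitz kdelta p q = \sum_(i < n) p`_i * q`_i.
Proof.
move=> pn; rewrite (toeplitzE kdelta (m := maxn n (size q)) pn); last first.
  by rewrite leq_maxr.
apply: eq_bigr => i _.
rewrite (bigD1 (widen_ord (leq_maxl n (size q)) i))//= big1 ?addr0.
  by rewrite kdelta_dist eqxx mulr1.
move=> j /eqP ji; rewrite kdelta_dist; case: eqP => [ij|]; last by rewrite mulr0.
by case: ji; apply: val_inj.
Qed.

Lemma toeplitz_kdelta_ge0 p : 0 <= toeplitz kdelta p p.
Proof.
by rewrite (toeplitz_kdelta _ (leqnn _)) sumr_ge0// => i _; rewrite -expr2 sqr_ge0.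
Qed.

Lemma coef_sqr_le_kdelta p i : p`_i ^+ 2 <= toeplitz kdelta p p.
Proof.
have [ip|pi] := ltnP i (size p); last first.
  by rewrite nth_default// expr0n toeplitz_kdelta_ge0.
rewrite (toeplitz_kdelta _ (leqnn _)) (bigD1 (Ordinal ip))//= -expr2 lerDl.
by rewrite sumr_ge0// => j _; rewrite -expr2 sqr_ge0.
Qed.

Lemma toeplitz_kdelta_low n p q : (size p <= n)%N ->
  (forall i, (i < n)%N -> q`_i = 0) -> toeplitz kdelta p q = 0.
Proof.
move=> pn q0; rewrite (toeplitz_kdelta _ pn) big1// => i _.
by rewrite q0// mulr0.
Qed.

End toeplitz.

Lemma cvg_sumr {R : realType} n (f : 'I_n -> nat -> R) (l : 'I_n -> R) :
  (forall i, f i @ \oo --> l i) ->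
  (fun j => \sum_i f i j) @ \oo --> \sum_i l i.
Proof. by move=> fl; apply: cvg_big => //; exact: add_continuous. Qed.

Lemma cvg_sumr0 {R : realType} n (f : 'I_n -> nat -> R) :
  (forall i, f i @ \oo --> 0) -> (fun j => \sum_i f i j) @ \oo --> 0.
Proof. by move=> /cvg_sumr; rewrite big1. Qed.

Lemma discriminant_le {R : realType} (a b c : R) : 0 <= c ->
  (forall t, 0 <= a + 2 * t * b + t ^+ 2 * c) -> b ^+ 2 <= a * c.
Proof.
move=> c0 h; have [c00|cn0] := eqVneq c 0.
  have [->|b0] := eqVneq b 0; first by rewrite expr0n/= c00 mulr0.
  (* When [c = 0] the quadratic is affine in [t]; this value of [t] makes it equal to -1. *)
  have := h (- (a + 1) / (2 * b)); rewrite c00 mulr0 addr0.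
  have -> : a + 2 * (- (a + 1) / (2 * b)) * b = -1 by field.
  by rewrite ler0N1.
have := h (- b / c).
have -> : a + 2 * (- b / c) * b + (- b / c) ^+ 2 * c = (a * c - b ^+ 2) / c.
  by field.
by rewrite pmulr_lge0 ?subr_ge0// invr_gt0 lt_def cn0.
Qed.

(** * Positive semidefinite Toeplitz forms and their innovation *)

Section psd_toeplitz.
Context {R : realType} (g : nat -> R).
Hypothesis psd : forall p : {poly R}, 0 <= toeplitz g p p.
Implicit Types p q r : {poly R}.
Local Notation B := (toeplitz g).
Local Notation N p := (toeplitz g p p).

Lemma toeplitz_quad p q (t : R) :
  N (p + t *: q) = N p + 2 * t * B p q + t ^+ 2 * N q.
Proof. by rewrite !toeplitz_lin (toeplitzC _ q); ring. Qed.

Lemma toeplitz_normN p : N (- p) = N p.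
Proof. by rewrite !toeplitz_lin opprK. Qed.

Lemma toeplitz_distC p q : N (p - q) = N (q - p).
Proof. by rewrite -toeplitz_normN opprB. Qed.

Lemma toeplitz_CS p q : B p q ^+ 2 <= N p * N q.
Proof. by apply: discriminant_le => // t; rewrite -toeplitz_quad. Qed.

Lemma toeplitz_normD p q : N (p + q) <= 2 * N p + 2 * N q.
Proof.
have : N (p - q) + N (p + q) = 2 * N p + 2 * N q.
  by rewrite !toeplitz_lin (toeplitzC _ q); ring.
by have := psd (p - q); lra.
Qed.

Lemma toeplitz_normB p q : N (p - q) <= 2 * N p + 2 * N q.
Proof. by rewrite (le_trans (toeplitz_normD _ _))// toeplitz_normN. Qed.

(** Horner induction: multiplication by ['X] is isometric, and a constant term costs only a scalar
    multiple. *)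
Lemma toeplitz_mul_bounded p : exists K : R, forall q, N (p * q) <= K * N q.
Proof.
elim/poly_ind: p => [|p c [K HK]].
  exists 0 => q; rewrite !mul0r -(scale0r 0) toeplitzZl mul0r //.
exists (2 * K + 2 * c ^+ 2) => q.
have -> : (p * 'X + c%:P) * q = 'X * (p * q) + c *: q.
  by rewrite mulrDl mul_polyC (mulrC p) mulrA.
apply: (le_trans (toeplitz_normD _ _)); rewrite toeplitzX.
by rewrite (toeplitzZl _ _ q) toeplitzZr; have := HK q; nra.
Qed.

Lemma toeplitz_poly_cvg0 n (u : nat -> nat -> R) :
  (forall i, (i < n)%N -> u ^~ i @ \oo --> 0) ->
  (fun j => N (\poly_(i < n) u j i)) @ \oo --> 0.
Proof.
move=> u0.
have -> : (fun j => N (\poly_(i < n) u j i)) =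
  (fun j => \sum_(i < n) \sum_(k < n) u j i * u j k * B 'X^i 'X^k).
  apply: boolp.funext => j; rewrite poly_def toeplitz_suml; apply: eq_bigr => i _.
  rewrite toeplitzZl toeplitz_sumr mulr_sumr; apply: eq_bigr => k _.
  by rewrite toeplitzZr mulrA.
apply: cvg_sumr0 => i; apply: cvg_sumr0 => k.
rewrite -(mul0r (B 'X^i 'X^k)) -[X in X * _](mul0r 0).
by apply: cvgM; [apply: cvgM; exact: u0|exact: cvg_cst].
Qed.


(* [s] is the squared distance of [1] to the multiples of ['X], and [E] is a
   minimizing sequence; it is Cauchy by the parallelogram law. *)
Lemma innovation : exists (s : R) (E : nat -> {poly R}),
  [/\ forall p : {poly R}, p`_0 = 1 -> s <= N p, forall j, (E j)`_0 = 1 &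
   forall j, N (E j) <= s + harmonic j].
Proof.
pose A : set R := [set N p | p in [set p : {poly R} | p`_0 = 1]].
have A0 : has_inf A.
  split; first by exists (N 1); exists 1 => //=; rewrite coef1.
  by exists 0 => _ [p _ <-].
have /boolp.choice[E HE] : forall j, exists p : {poly R},
    p`_0 = 1 /\ N p <= inf A + harmonic j.
  move=> j; have hj : 0 < harmonic j :> R by rewrite /= invr_gt0.
  by have [_ [p p0 <-] /ltW pj] := inf_adherent hj A0; exists p.
exists (inf A), E; split=> [|j|j]; [|by have [] := HE j|by have [] := HE j].
by move=> p p0; apply: ge_inf; [exact: A0.2|exists p].
Qed.

Section innovation_sequence.
Variables (s : R) (E : nat -> {poly R}).
Hypotheses (s_le : forall p : {poly R}, p`_0 = 1 -> s <= N p) (E0 : forall j, (E j)`_0 = 1).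
Hypothesis (E_le : forall j, N (E j) <= s + harmonic j).

Lemma innovation_cvg : (fun j => N (E j)) @ \oo --> s.
Proof.
apply: (@squeeze_cvgr _ _ _ _ (fun=> s) (fun j => s + harmonic j)).
- by apply: nearW => j; rewrite s_le//= E_le.
- exact: cvg_cst.
- by rewrite -[X in _ --> X]addr0; apply: cvgD; [exact: cvg_cst|exact: cvg_harmonic].
Qed.

(** The midpoint of [E i] and [E j] again has constant coefficient 1, so its form is at least [s];
    the parallelogram law turns this into a bound on the distance. *)
Lemma innovation_dist i j :
  N (E i - E j) <= 2 * harmonic i + 2 * harmonic j.
Proof.
have h : s <= N (2^-1 *: E i + 2^-1 *: E j).
  by apply: s_le; rewrite coefD !coefZ !E0; lra.
have : N (E i - E j) + 4 * N (2^-1 *: E i + 2^-1 *: E j) =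
    2 * N (E i) + 2 * N (E j).
  by rewrite !toeplitz_lin (toeplitzC _ (E i) (E j)); field.
have := E_le i; have := E_le j; move: (harmonic i) (harmonic j) => a b; lra.
Qed.

(** Perturbing [E j] by multiples of ['X * p] keeps the constant coefficient 1, so the resulting
    quadratic in [t] stays above [s]. Its discriminant bounds the defect of orthogonality by the
    defect of minimality. *)
Lemma innovation_orth p j : B (E j) ('X * p) ^+ 2 <= N p * harmonic j.
Proof.
have h t : s <= N (E j) + 2 * t * B (E j) ('X * p) + t ^+ 2 * N p.
  rewrite -(toeplitzX _ p p) -toeplitz_quad; apply: s_le.
  by rewrite coefD coefZ coefXM E0 mulr0 addr0.
rewrite (mulrC (N p)); apply: discriminant_le => // t.
by have := h t; have := E_le j; move: (harmonic j) => e; lra.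
Qed.

(** Cancelling the common power of ['X] leaves [E j] against a shift of itself. For a nontrivial
    shift [innovation_orth] bounds the square by [N (E j) * harmonic j], and [N (E j)] tends to
    [s]. *)
Lemma innovation_shift_cvg i k :
  (fun j => B ('X^i * E j) ('X^k * E j)) @ \oo --> s * (i == k)%:R.
Proof.
wlog ik : i k / (i <= k)%N => [hw|].
  have [/hw//|/ltnW/hw] := leqP i k; rewrite eq_sym.
  by under eq_fun do rewrite toeplitzC.
have -> : (fun j => B ('X^i * E j) ('X^k * E j)) =
    (fun j => B (E j) ('X^(k - i) * E j)).
  apply: boolp.funext => j; rewrite -{1}(subnKC ik) exprD -mulrA.
  by rewrite toeplitzXn.
have [->|ik'] := eqVneq i k.
  by under eq_fun do rewrite subnn expr0 mul1r; rewrite mulr1; exact: innovation_cvg.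
have {ik ik'} : (0 < k - i)%N by rewrite subn_gt0 ltn_neqAle ik' ik.
case: (k - i)%N => // n _; rewrite mulr0; apply/cvgr0Pnorm_le => e e0.
have /cvgr0Pnorm_le /(_ (e ^+ 2)) : (fun j => N (E j) * harmonic j) @ \oo --> 0.
  rewrite -(mulr0 s); apply: cvgM; [exact: innovation_cvg|exact: cvg_harmonic].
move=> /(_ (exprn_gt0 _ e0)); apply: filterS => j.
rewrite ger0_norm => [h|]; last first.
  by apply: mulr_ge0; [exact: psd|rewrite /= invr_ge0].
rewrite -(@ler_pXn2r _ 2)// ?nnegrE ?(ltW e0)// real_normK ?num_real//.
by rewrite (le_trans _ h)// (exprS 'X n) -mulrA (le_trans (innovation_orth _ _))// toeplitzXn.
Qed.

(** In the limit the shifted innovations are orthogonal of squared norm [s], so multiplying them by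
    polynomials reproduces the standard form up to the factor [s]. *)
Lemma innovation_mul_cvg p q :
  (fun j => B (p * E j) (q * E j)) @ \oo --> s * toeplitz kdelta p q.
Proof.
have -> : (fun j => B (p * E j) (q * E j)) = (fun j =>
    \sum_(i < size p) \sum_(k < size q)
      p`_i * q`_k * B ('X^i * E j) ('X^k * E j)).
  apply: boolp.funext => j; rewrite -{1}(coefK p) -{1}(coefK q) !poly_def.
  rewrite !mulr_suml toeplitz_suml; apply: eq_bigr => i _.
  rewrite toeplitz_sumr; apply: eq_bigr => k _.
  by rewrite -2!scalerAl toeplitzZl toeplitzZr mulrA.
rewrite /toeplitz mulr_sumr; apply: cvg_sumr => i.
rewrite mulr_sumr; apply: cvg_sumr => k.
rewrite mulrCA; apply: cvgM; first exact: cvg_cst.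
by rewrite kdelta_dist; exact: innovation_shift_cvg.
Qed.

End innovation_sequence.

End psd_toeplitz.

(** * Nonpositive correlations *)

Section nonpositive_correlations.
Context {R : realType} (g : nat -> R).
Hypothesis psd : forall p : {poly R}, 0 <= toeplitz g p p.
Hypothesis g_le0 : forall n, (0 < n)%N -> g n <= 0.

Let S n := \sum_(m < n) - g m.+1.

Let S_homo n m : (n <= m)%N -> S n <= S m.
Proof.
move=> /subnKC <-; elim: (m - n)%N => [|k IH]; first by rewrite addn0.
by rewrite addnS /S big_ord_recr/= (le_trans IH)// lerDl oppr_ge0 g_le0.
Qed.

(** In a Toeplitz matrix of size [i + 1 + k], row [i] has [i] entries to the left of the diagonal
    and [k] to its right. *)
Let row_sum i k :
  \sum_(j < i.+1 + k) g ((i - j) + (j - i))%N = g 0%N - S i - S k.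
Proof.
elim: k => [|k IH]; last first.
  rewrite addnS big_ord_recr/= IH /S big_ord_recr/=.
  have -> : (i - (i.+1 + k) + (i.+1 + k - i) = k.+1)%N by lia.
  by ring.
have -> : S 0%N = 0 by rewrite /S big_ord0.
rewrite addn0 subr0 (reindex_inj rev_ord_inj)/= big_ord_recl/= /S sumrN opprK.
congr (g _ + _); first lia.
by apply: eq_bigr => j _; congr g; rewrite /bump/=; have := ltn_ord j; lia.
Qed.

Let row_sum_le M (i : 'I_M) :
  \sum_(j < M) g ((i - j) + (j - i))%N = g 0%N - S i - S (M - i.+1).
Proof.
have iM := ltn_ord i; rewrite -row_sum.
by have -> : (i.+1 + (M - i.+1) = M)%N by lia.
Qed.

(* Positivity of the form on [1 + X + ... + X^(M-1)], as [M] tends to infinity. *)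
Lemma sum_nonpos_correlation K : 2 * S K <= g 0%N.
Proof.
(* The entries of the matrix of size [K + L] add up to [(K + L) * g 0] minus twice the sum of the
   [S i]. The first [K] values of [S] are nonnegative, and the last [L] are at least [S K]. *)
have h L : 2 * (L%:R * S K) <= (K + L)%:R * g 0%N.
  pose p : {poly R} := \poly_(i < K + L) 1.
  have := psd p.
  rewrite (toeplitzE g (n := K + L) (m := K + L)) ?size_poly//.
  have -> : \sum_(i < K + L) \sum_(j < K + L)
      p`_i * p`_j * g (i - j + (j - i))%N =
      \sum_(i < K + L) (g 0%N - S i - S (K + L - i.+1)).
    apply: eq_bigr => i _; rewrite -row_sum_le; apply: eq_bigr => j _.
    by rewrite !coef_poly !ltn_ord !mul1r.
  rewrite !big_split/= [X in _ + _ + X](reindex_inj rev_ord_inj)/=.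
  have -> : \sum_(j < K + L) - S (K + L - (K + L - j.+1).+1) =
      \sum_(j < K + L) - S j.
    by apply: eq_bigr => j _; congr (- S _); have := ltn_ord j; lia.
  rewrite sumr_const card_ord sumrN -mulr_natl.
  suff : L%:R * S K <= \sum_(i < K + L) S i by lra.
  rewrite big_split_ord/= mulr_natl -[in leLHS](card_ord L) -sumr_const.
  rewrite -[leLHS]add0r lerD//; last by apply: ler_sum => i _; rewrite S_homo// leq_addr.
  by apply: sumr_ge0 => i _; rewrite (le_trans _ (S_homo (leq0n _)))// /S big_ord0.
(* If [2 * S K] exceeded [g 0], the bound [h L] would fail for large [L]. *)
rewrite leNgt; apply/negP => lt.
have [L hL] : exists L : nat, K%:R * g 0%N < L%:R * (2 * S K - g 0%N).
  exists (Num.truncn (K%:R * g 0%N / (2 * S K - g 0%N))).+1.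
  by rewrite -ltr_pdivrMr ?subr_gt0// truncnS_gt.
have := h L; rewrite natrD mulrDl; lra.
Qed.

(* Since [2 a b <= a ^+ 2 + b ^+ 2], the form is at least the sum of the
   [p`_i ^+ 2] weighted by the row sums of the Toeplitz matrix; these are all
   nonnegative, and the one of index [0] is at least [g 0 / 2]. *)
Lemma nonpos_correlation_innovation (p : {poly R}) :
  p`_0 = 1 -> g 0%N / 2 <= toeplitz g p p.
Proof.
move=> p0; set M := size p.
have Mgt0 : (0 < M)%N.
  by rewrite size_poly_gt0; apply: contra_eq_neq p0 => ->; rewrite coef0 eq_sym oner_eq0.
pose w (i j : nat) := g ((i - j) + (j - i))%N.
have wC i j : w i j = w j i by rewrite /w addnC.
have h1 : \sum_(i < M) p`_i ^+ 2 * (\sum_(j < M) w i j) <= toeplitz g p p.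
  have -> : \sum_(i < M) p`_i ^+ 2 * (\sum_(j < M) w i j) =
      \sum_(i < M) \sum_(j < M) (p`_i ^+ 2 + p`_j ^+ 2) / 2 * w i j.
    transitivity (\sum_(i < M) \sum_(j < M) (p`_i ^+ 2 / 2 * w i j) +
        \sum_(i < M) \sum_(j < M) (p`_j ^+ 2 / 2 * w i j)).
      rewrite [X in _ = _ + X]exchange_big/= -big_split/=; apply: eq_bigr => i _.
      rewrite -big_split/= mulr_sumr; apply: eq_bigr => j _.
      by rewrite (wC j i); field.
    rewrite -big_split/=; apply: eq_bigr => i _; rewrite -big_split/=.
    by apply: eq_bigr => j _; field.
  apply: ler_sum => i _; apply: ler_sum => j _; rewrite -/(w i j).
  have [->|ij] := eqVneq i j; first by have -> : (p`_j ^+ 2 + p`_j ^+ 2) / 2 = p`_j * p`_j by field.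
  have : w i j <= 0 by apply: g_le0; move: ij; rewrite -val_eqE/=; lia.
  by move: (w i j) p`_i p`_j => x a b x0; have := sqr_ge0 (a - b); nra.
apply: le_trans h1; rewrite -(prednK Mgt0) big_ord_recl/= p0 expr1n mul1r.
rewrite -[leLHS]addr0 lerD//.
  rewrite /w prednK// (row_sum_le (Ordinal Mgt0)) /= /S big_ord0 subr0.
  by have := sum_nonpos_correlation (M - 1); rewrite /S; lra.
(* Each of the two values of [S] in a row sum is at most [g 0 / 2]. *)
rewrite sumr_ge0// => i _; apply: mulr_ge0; first exact: sqr_ge0.
have iM : (bump 0 i < M)%N by rewrite /bump/=; have := ltn_ord i; lia.
rewrite /w prednK// (row_sum_le (Ordinal iM)).
have := sum_nonpos_correlation (bump 0 i).
have := sum_nonpos_correlation (M - (bump 0 i).+1).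
by rewrite /S/=; lra.
Qed.

End nonpositive_correlations.

(** * Factorization of a Toeplitz form dominating the identity *)

Section sequence_facts.
Context {R : realType}.
Implicit Types u v : nat -> R.

Lemma cauchy_seqr u :
  (forall e, 0 < e -> exists n, forall i j, (n <= i)%N -> (n <= j)%N ->
    `|u i - u j| <= e) -> cvg (u @ \oo).
Proof.
move=> h; apply/cauchy_cvgP/cauchy_ballP => e e0.
have [n hn] := h _ (divr_gt0 e0 (ltr0Sn R 1)).
exists ([set u i | i in [set i | (n <= i)%N]], [set u i | i in [set i | (n <= i)%N]]).
  by split; exists n => // i /= ni; exists i.
move=> [_ _] [[i ni <-] [j nj <-]]; rewrite /ball/=.
by apply: le_lt_trans (hn _ _ ni nj) _; rewrite ltr_pdivrMr// mulr_natr mulr2n ltrDl.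
Qed.

Lemma cauchy_seq_of_cvg u : cvg (u @ \oo) ->
  forall e, 0 < e -> exists n, forall i j, (n <= i)%N -> (n <= j)%N ->
    `|u i - u j| <= e.
Proof.
move=> /cvg_ex[l ul] e e0.
have /cvgrPdist_le/(_ (e / 2)) := ul; rewrite divr_gt0// => /(_ isT)[n _ hn].
exists n => i j ni nj; rewrite (le_trans (ler_distD l _ _))// distrC [leRHS]splitr.
by rewrite lerD// hn.
Qed.

Lemma cvg0_near u : u @ \oo --> 0 ->
  forall e, 0 < e -> exists n, forall i, (n <= i)%N -> `|u i| <= e.
Proof. by move=> /cvgr0Pnorm_le u0 e /u0[n _ hn]; exists n => i ni; exact: hn. Qed.

Lemma cvg0_sqr u v : (forall n, u n ^+ 2 <= v n) -> v @ \oo --> 0 ->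
  u @ \oo --> 0.
Proof.
move=> uv v0; apply/cvgr0Pnorm_le => e e0.
have [n hn] := cvg0_near v0 (exprn_gt0 2 e0); exists n => // i /= ni.
rewrite -(@ler_pXn2r _ 2)// ?nnegrE ?(ltW e0)// real_normK ?num_real//.
by rewrite (le_trans (uv i))// (le_trans (ler_norm _))// hn.
Qed.

(** Inversion of a formal power series with constant term 1. Each coefficient depends on all earlier
    ones, so the recursion builds the lists [t n] of the first [n] coefficients. *)
Lemma inverse_series (e : nat -> R) : e 0%N = 1 ->
  exists c : nat -> R, forall i, \sum_(l < i.+1) c l * e (i - l)%N = (i == 0%N)%:R.
Proof.
move=> e0.
pose step (t : seq R) :=
  rcons t ((size t == 0%N)%:R - \sum_(l < size t) t`_l * e (size t - l)%N).
pose t n := iter n step [::]; pose c k := (t k.+1)`_k.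
have st n : size (t n) = n.
  by elim: n => //= n IH; rewrite size_rcons -/(t n) IH.
have tc n k : (k < n)%N -> (t n)`_k = c k.
  elim: n => // n IH; rewrite ltnS leq_eqVlt => /predU1P[->//|kn].
  by rewrite /t iterS -/(t n) nth_rcons st kn IH.
exists c => i; rewrite big_ord_recr/= subnn e0 mulr1 /c /t iterS -/(t i).
rewrite nth_rcons st ltnn eqxx addrC -addrA -[RHS]addr0; congr (_ + _).
apply/eqP; rewrite addrC subr_eq0; apply/eqP/eq_bigr => l _.
by rewrite tc// ltn_ord.
Qed.

End sequence_facts.

(** Limits live in the completion of the polynomials, which is never built: elements of it are
    represented by Cauchy sequences. *)
Definition toeplitz_cauchy {R : realType} (g : nat -> R) (P : nat -> {poly R}) :=
  forall e, 0 < e -> exists n, forall i j, (n <= i)%N -> (n <= j)%N ->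
    toeplitz g (P i - P j) (P i - P j) <= e.

Section kdelta_series.
Context {R : realType} (c : nat -> R).

Let C n : {poly R} := \poly_(k < n) c k.

Lemma kdelta_norm_poly n : toeplitz kdelta (C n) (C n) = \sum_(k < n) c k ^+ 2.
Proof.
rewrite (toeplitz_kdelta _ (size_poly n _)); apply: eq_bigr => k _.
by rewrite !coef_poly ltn_ord.
Qed.

(** The difference of two truncations carries exactly the coefficients between [n] and [m], so its
    square norm is a difference of partial sums. *)
Lemma kdelta_dist_poly n m : toeplitz kdelta (C n - C m) (C n - C m) =
  `|\sum_(k < n) c k ^+ 2 - \sum_(k < m) c k ^+ 2|.
Proof.
wlog nm : n m / (n <= m)%N => [hw|].
  by have [/hw//|/ltnW/hw] := leqP n m; rewrite distrC toeplitz_distC.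
have CC : toeplitz kdelta (C n) (C m) = \sum_(k < n) c k ^+ 2.
  rewrite (toeplitz_kdelta _ (size_poly n _)); apply: eq_bigr => k _.
  by rewrite !coef_poly ltn_ord (leq_trans (ltn_ord k) nm).
rewrite ler0_norm ?opprB; last first.
  rewrite subr_le0 -(subnKC nm); elim: (m - n)%N => [|k IH]; first by rewrite addn0.
  by rewrite addnS big_ord_recr/= (le_trans IH)// lerDl sqr_ge0.
rewrite !toeplitz_lin (toeplitzC _ (C m) (C n)) CC !kdelta_norm_poly; ring.
Qed.

Lemma kdelta_series_cvg (M : R) : (forall n, \sum_(k < n) c k ^+ 2 <= M) ->
  cvg ((fun n => \sum_(k < n) c k ^+ 2) @ \oo).
Proof.
move=> cM; apply: nondecreasing_is_cvgn.
  by apply/nondecreasing_seqP => n; rewrite big_ord_recr/= lerDl sqr_ge0.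
by exists M => _ [n _ <-].
Qed.

Lemma kdelta_series_cauchy (M : R) : (forall n, \sum_(k < n) c k ^+ 2 <= M) ->
  toeplitz_cauchy kdelta C.
Proof.
move=> /kdelta_series_cvg/cauchy_seq_of_cvg + e => /[apply] -[n hn].
by exists n => i j ni nj; rewrite kdelta_dist_poly hn.
Qed.

End kdelta_series.

(** * Wold decomposition and the outer factor *)

Section outer_factor.
Context {R : realType} (g : nat -> R).
Local Notation B := (toeplitz g).
Local Notation N p := (toeplitz g p p).
Local Notation I := (toeplitz (@kdelta R)).
Hypothesis dom : forall p : {poly R}, I p p <= N p.
Hypothesis closable : forall P : nat -> {poly R}, toeplitz_cauchy g P ->
  (fun j => I (P j) (P j)) @ \oo --> 0 -> (fun j => N (P j)) @ \oo --> 0.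

Let psd (p : {poly R}) : 0 <= N p.
Proof. exact: le_trans (toeplitz_kdelta_ge0 p) (dom p). Qed.

Variables (s : R) (E : nat -> {poly R}).
Hypothesis s_le : forall p : {poly R}, p`_0 = 1 -> s <= N p.
Hypothesis E0 : forall j, (E j)`_0 = 1.
Hypothesis E_le : forall j, N (E j) <= s + harmonic j.

Let s_ge1 : 1 <= s.
Proof.
apply: (cvgr_to_ge (innovation_cvg s_le E0 E_le)); apply: nearW => j.
by rewrite (le_trans _ (dom _))// (le_trans _ (coef_sqr_le_kdelta (E j) 0))// E0 expr1n.
Qed.

Let harmonic_small e : 0 < e -> exists n, forall j, (n <= j)%N -> harmonic j <= e :> R.
Proof.
move=> e0; have [n hn] := cvg0_near (@cvg_harmonic R) e0.
by exists n => j nj; rewrite (le_trans (ler_norm _))// hn.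
Qed.

Let harmonic_ge0 j : 0 <= harmonic j :> R. Proof. by rewrite /= invr_ge0. Qed.

(** Since the form dominates that of [kdelta], each coefficient is continuous for it, and [E] is
    Cauchy. *)
Let coef_E_cvg k : cvg ((fun j => (E j)`_k) @ \oo).
Proof.
apply: cauchy_seqr => e e0.
have [n hn] := harmonic_small (divr_gt0 (exprn_gt0 2 e0) (ltr0Sn R 3)).
exists n => i j /hn hi /hn hj.
rewrite -(@ler_pXn2r _ 2)// ?nnegrE ?(ltW e0)// real_normK ?num_real//.
rewrite -coefB (le_trans (coef_sqr_le_kdelta _ _))// (le_trans (dom _))//.
by rewrite (le_trans (innovation_dist s_le E0 E_le _ _))//; lra.
Qed.

Variable c : nat -> R.
Hypothesis c_inv : forall i,
  \sum_(l < i.+1) c l * lim ((fun j => (E j)`_(i - l)) @ \oo) = (i == 0%N)%:R.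

(* The series [c] is the inverse of the coefficientwise limit of [E], so the
   coefficients of [D n j] of index less than [n] tend to [0] with [j]: [C n * E j]
   is, up to [o(1)], the projection of [1] on the first [n] innovations. *)
Let C n : {poly R} := \poly_(k < n) c k.
Let D n j := 1 - C n * E j.
Let u n := I (C n) (C n).
Let rho n := g 0%N - s * u n.

Let low_cvg n i : (i < n)%N -> (fun j => (D n j)`_i) @ \oo --> 0.
Proof.
move=> ni; have -> : (fun j => (D n j)`_i) =
    (fun j => (i == 0%N)%:R - \sum_(l < i.+1) (C n)`_l * (E j)`_(i - l)).
  by apply: boolp.funext => j; rewrite coefB coef1 coefM.
suff : (fun j => (i == 0%N)%:R - \sum_(l < i.+1) (C n)`_l * (E j)`_(i - l)) @ \oo
    --> ((i == 0%N)%:R - (i == 0%N)%:R : R) by rewrite subrr.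
rewrite -[X in _ --> _ - X]c_inv.
apply: cvgB; [exact: cvg_cst|apply: cvg_sumr => l].
apply: cvgM; last exact: coef_E_cvg.
rewrite coef_poly (leq_ltn_trans _ ni) ?leq_ord//; exact: cvg_cst.
Qed.

Let take_cvg n : (fun j => N (take_poly n (D n j))) @ \oo --> 0.
Proof. exact: (@toeplitz_poly_cvg0 _ g n (fun j i => (D n j)`_i) (@low_cvg n)). Qed.

Let CE_cvg n : (fun j => N (C n * E j)) @ \oo --> s * u n.
Proof. exact: innovation_mul_cvg s_le E0 E_le _ _. Qed.

(** The part of [D n j] of degree less than [n] is asymptotically negligible. The rest is divisible
    by ['X^n], hence by ['X^k * 'X], and so is almost orthogonal to ['X^k * E j]. *)
Let orth n k : (k < n)%N -> (fun j => B (D n j) ('X^k * E j)) @ \oo --> 0.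
Proof.
move=> kn; pose T j := take_poly n (D n j).
(* The two summands bound the contributions of the low part [T j] and of the high part ['X^n * Q];
   the parenthesis before [harmonic j] bounds [N Q]. *)
apply: (@cvg0_sqr _ _ (fun j => 2 * (N (T j) * N (E j)) +
  2 * (4 * N 1 + 4 * N (C n * E j) + 2 * N (T j)) * harmonic j)).
  move=> j; pose Q := drop_poly n (D n j).
  have DE : D n j = T j + 'X^n * Q by rewrite mulrC poly_take_drop.
  have h1 : N Q <= 4 * N 1 + 4 * N (C n * E j) + 2 * N (T j).
    have := toeplitz_normB psd (D n j) (T j).
    have -> : D n j - T j = 'X^n * Q by rewrite [in LHS]DE addrAC subrr add0r.
    by rewrite toeplitzXn; have := toeplitz_normB psd 1 (C n * E j); rewrite -/(D n j); lra.
  have h2 := toeplitz_CS psd (T j) ('X^k * E j); rewrite toeplitzXn in h2.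
  have h3 : B ('X^n * Q) ('X^k * E j) ^+ 2 <= N Q * harmonic j.
    have -> : 'X^n * Q = 'X^k * ('X * ('X^(n - k.+1) * Q)).
      by rewrite !mulrA -exprSr -exprD subnKC.
    by rewrite toeplitzXn toeplitzC (le_trans (innovation_orth psd s_le E0 E_le _ _))// toeplitzXn.
  rewrite DE toeplitzDl; move: (B (T j) _) (B ('X^n * Q) _) h2 h3 => a b h2 h3.
  have : (a + b) ^+ 2 <= 2 * a ^+ 2 + 2 * b ^+ 2 by have := sqr_ge0 (a - b); nra.
  have : N Q * harmonic j <= (4 * N 1 + 4 * N (C n * E j) + 2 * N (T j)) * harmonic j.
    by rewrite ler_wpM2r.
  by move: (harmonic j) h3 => hj h3; lra.
have -> : 0 = 2 * (0 * s) +
    2 * (4 * N 1 + 4 * (s * u n) + 2 * 0) * 0 :> R by ring.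
apply: cvgD.
  apply: cvgM; [exact: cvg_cst|apply: cvgM; [exact: take_cvg|]].
  exact: innovation_cvg s_le E0 E_le.
apply: cvgM; last exact: cvg_harmonic.
apply: cvgM; first exact: cvg_cst.
apply: cvgD; last by apply: cvgM; [exact: cvg_cst|exact: take_cvg].
apply: cvgD; first exact: cvg_cst.
by apply: cvgM; [exact: cvg_cst|exact: CE_cvg].
Qed.

Let orthC n : (fun j => B (D n j) (C n * E j)) @ \oo --> 0.
Proof.
have -> : (fun j => B (D n j) (C n * E j)) =
    (fun j => \sum_(k < n) c k * B (D n j) ('X^k * E j)).
  apply: boolp.funext => j; rewrite /C poly_def mulr_suml toeplitz_sumr.
  by apply: eq_bigr => k _; rewrite -scalerAl toeplitzZr.
apply: cvg_sumr0 => k; rewrite -(mulr0 (c k)).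
by apply: cvgM; [exact: cvg_cst|exact: orth].
Qed.

(** Pythagoras: [1] splits into [D n j] and [C n * E j], which become orthogonal as [j] grows. *)
Let D_cvg n : (fun j => N (D n j)) @ \oo --> rho n.
Proof.
have -> : (fun j => N (D n j)) =
    (fun j => g 0%N - 2 * B (D n j) (C n * E j) - N (C n * E j)).
  apply: boolp.funext => j; have <- : N 1 = g 0%N by have := toeplitz1Xn g 0.
  have -> : N 1 = N (D n j + C n * E j) by rewrite subrK.
  by move: (D n j) (C n * E j) => a b; rewrite !toeplitz_lin (toeplitzC _ b a); ring.
have -> : rho n = g 0%N - 2 * 0 - s * u n by rewrite mulr0 subr0.
apply: cvgB; last exact: CE_cvg.
by apply: cvgB; [exact: cvg_cst|apply: cvgM; [exact: cvg_cst|exact: orthC]].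
Qed.

Let rho_ge0 n : 0 <= rho n.
Proof. by apply: (cvgr_to_ge (@D_cvg n)); apply: nearW => j. Qed.

Let uE n : u n = \sum_(k < n) c k ^+ 2.
Proof. exact: kdelta_norm_poly. Qed.

Let C_dist n m : I (C n - C m) (C n - C m) = `|u n - u m|.
Proof. by rewrite kdelta_dist_poly !uE. Qed.

Let u_le n : u n <= g 0%N.
Proof.
have := rho_ge0 n; have := s_ge1.
by have := toeplitz_kdelta_ge0 (C n); rewrite -/(u n) /rho; nra.
Qed.

Let u_cvg : cvg (u @ \oo).
Proof.
have -> : u = (fun n => \sum_(k < n) c k ^+ 2) by apply: boolp.funext.
by apply: (@kdelta_series_cvg _ _ (g 0%N)) => n; rewrite -uE.
Qed.

(** The limit of [D n j] in [j] belongs to the closure of the multiples of ['X^n]; [P] is a multiple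
    of ['X^n] approximating it. It is obtained by removing the low part of a late term, and works
    for all later [j] because multiplication by [C n] is bounded. *)
Let near_high_part n : exists P : {poly R}, (forall i, (i < n)%N -> P`_i = 0) /\
  exists J, forall j, (J <= j)%N -> N (D n j - P) <= harmonic n.
Proof.
have [K HK] := toeplitz_mul_bounded psd (C n).
have h0 : (fun j => 8 * `|K| * harmonic j + 2 * N (take_poly n (D n j))) @ \oo --> 0.
  have -> : 0 = 8 * `|K| * 0 + 2 * 0 :> R by rewrite !mulr0 addr0.
  by apply: cvgD; apply: cvgM;
    [exact: cvg_cst|exact: cvg_harmonic|exact: cvg_cst|exact: take_cvg].
have hn : 0 < harmonic n :> R by rewrite /= invr_gt0.
have [J HJ] := cvg0_near h0 hn.
exists (D n J - take_poly n (D n J)); split.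
  by move=> i ni; rewrite coefB coef_take_poly ni subrr.
exists J => j Jj.
have -> : D n j - (D n J - take_poly n (D n J)) =
    C n * (E J - E j) + take_poly n (D n J).
  by rewrite /D mulrBr; ring.
rewrite (le_trans (toeplitz_normD psd _ _))//.
apply: (le_trans _ (le_trans (ler_norm _) (HJ _ (leqnn J)))).
rewrite lerD2r.
suff : N (C n * (E J - E j)) <= `|K| * (4 * harmonic J).
  by move: (harmonic J) => a; lra.
apply: (le_trans (HK _)).
apply: (le_trans (ler_wpM2r (psd _) (ler_norm K))).
rewrite ler_wpM2l// (le_trans (innovation_dist s_le E0 E_le _ _))//.
have : harmonic j <= harmonic J :> R by rewrite /= lef_pV2 ?posrE// ler_nat.
by move: (harmonic j) (harmonic J) => a b; lra.
Qed.

(* There is no deterministic part: the residuals form a Cauchy sequence for the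
   Toeplitz form whose terms have orders tending to infinity, hence they tend to
   [0] for the smaller form of [kdelta], and so also for the larger one. *)
Let rho_cvg : rho @ \oo --> 0.
Proof.
have /boolp.choice[P HP] := near_high_part.
(* Compare through [D n j - D m j], which is [(C n - C m) * E j] up to sign and has limiting form
   [s * |u n - u m|]. *)
have Pdist n m : N (P n - P m) <=
    2 * (s * `|u n - u m|) + 4 * harmonic n + 4 * harmonic m.
  have [_ [Jn hn]] := HP n; have [_ [Jm hm]] := HP m.
  have : (fun j => 2 * N ((C n - C m) * E j) + 4 * harmonic n + 4 * harmonic m) @ \oo
      --> 2 * (s * `|u n - u m|) + 4 * harmonic n + 4 * harmonic m.
    apply: cvgD; last exact: cvg_cst.
    apply: cvgD; last exact: cvg_cst.
    apply: cvgM; first exact: cvg_cst.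
    by rewrite -C_dist; exact: innovation_mul_cvg s_le E0 E_le _ _.
  move/cvgr_to_ge; apply; exists (maxn Jn Jm) => // j /=.
  rewrite geq_max => /andP[/hn {}hn /hm {}hm].
  have -> : P n - P m = (D n j - D m j) - ((D n j - P n) - (D m j - P m)) by ring.
  rewrite (le_trans (toeplitz_normB psd _ _))//.
  have -> : N (D n j - D m j) = N ((C n - C m) * E j).
    by rewrite -toeplitz_normN; congr (B _ _); rewrite /D mulrBl; ring.
  have := toeplitz_normB psd (D n j - P n) (D m j - P m).
  change (N (D n j - P n - (D m j - P m)) <=
    2 * N (D n j - P n) + 2 * N (D m j - P m) ->
    2 * N ((C n - C m) * E j) + 2 * N (D n j - P n - (D m j - P m)) <=
    2 * N ((C n - C m) * E j) + 4 * harmonic n + 4 * harmonic m).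
  move: (harmonic n) (harmonic m) hn hm => a b hn hm; lra.
have Pcauchy : toeplitz_cauchy g P.
  move=> e e0; have [n1 h1] := harmonic_small (divr_gt0 e0 (ltr0Sn R 15)).
  have s0 : 0 < 4 * s by rewrite mulr_gt0// (lt_le_trans _ s_ge1).
  have [n2 h2] := cauchy_seq_of_cvg u_cvg (divr_gt0 e0 s0).
  exists (maxn n1 n2) => i j; rewrite !geq_max => /andP[/h1 i1 i2] /andP[/h1 j1 j2].
  rewrite (le_trans (Pdist _ _))//; have := h2 _ _ i2 j2; rewrite ler_pdivlMr// => h3.
  by move: (harmonic i) (harmonic j) i1 j1 => a b i1 j1; lra.
(* For [m] at least the size of [P n], the polynomials [P n] and [P m] have disjoint supports. Hence
   the standard norm of [P n] is at most that of [P n - P m], which the Cauchy property controls. *)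
have IP : (fun n => I (P n) (P n)) @ \oo --> 0.
  apply/cvgr0Pnorm_le => e /Pcauchy[n0 h0]; exists n0 => // n /= nn0.
  rewrite ger0_norm ?toeplitz_kdelta_ge0//.
  have := h0 n (maxn n (size (P n))) nn0 (leq_trans nn0 (leq_maxl _ _)).
  set m := maxn _ _ => h; rewrite (le_trans _ h)// (le_trans _ (dom _))//.
  have PnPm : I (P n) (P m) = 0.
    apply: (@toeplitz_kdelta_low _ (size (P n))) => // i iP.
    by have [-> //] := HP m; rewrite (leq_trans iP)// leq_maxr.
  rewrite !toeplitz_lin (toeplitzC _ (P m) (P n)) PnPm oppr0 addr0 add0r opprK.
  by rewrite lerDl toeplitz_kdelta_ge0.
have NP := closable Pcauchy IP.
have v0 : (fun n => 2 * N (P n) + 2 * harmonic n) @ \oo --> 0.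
  have -> : 0 = 2 * 0 + 2 * 0 :> R by rewrite !mulr0 addr0.
  by apply: cvgD; apply: cvgM;
    [exact: cvg_cst|exact: NP|exact: cvg_cst|exact: cvg_harmonic].
apply: (squeeze_cvgr _ (cvg_cst 0) v0); apply: nearW => n; rewrite rho_ge0 andTb.
apply: (cvgr_to_le (@D_cvg n)); have [_ [J hJ]] := HP n; exists J => // j /hJ {}hJ.
have := toeplitz_normD psd (D n j - P n) (P n); rewrite subrK.
by move: (harmonic n) hJ => a hJ; lra.
Qed.

(** Both sides are forms of [1] and ['X^m], exactly or after projection on the first [n]
    innovations; the error is controlled by the residual [rho n]. *)
Let correlation_cvg m : (fun n => s * I (C n) ('X^m * C n)) @ \oo --> g m.
Proof.
suff : (fun n => s * I (C n) ('X^m * C n) - g m) @ \oo --> 0.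
  move=> h; have -> : (fun n => s * I (C n) ('X^m * C n)) =
      (fun n => s * I (C n) ('X^m * C n) - g m + g m).
    by apply: boolp.funext => n; rewrite subrK.
  by rewrite -[X in _ --> X]add0r; apply: cvgD; [exact: h|exact: cvg_cst].
apply: (@cvg0_sqr _ _ (fun n => 4 * g 0%N * rho n)); last first.
  by rewrite -(mulr0 (4 * g 0%N)); apply: cvgM; [exact: cvg_cst|exact: rho_cvg].
move=> n; set x := I _ _.
have g0 : N 1 = g 0%N by have := toeplitz1Xn g 0.
(* Substituting [s * u n = g 0 - rho n], the left side is [4 * g 0 * rho n - 2 * rho n ^+ 2]. *)
have : 2 * (rho n * g 0%N) + 2 * (s * u n * rho n) <= 4 * g 0%N * rho n.
  have -> : s * u n = g 0%N - rho n by rewrite /rho; ring.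
  by move: (rho n) => r; have := sqr_ge0 r; nra.
apply: le_trans.
have hl : (fun j => (B (C n * E j) ('X^m * C n * E j) - g m) ^+ 2) @ \oo -->
    (s * x - g m) ^+ 2.
  rewrite expr2; under eq_fun do rewrite expr2.
  have h : (fun j => B (C n * E j) ('X^m * C n * E j) - g m) @ \oo --> s * x - g m.
    apply: cvgB; last exact: cvg_cst.
    exact: innovation_mul_cvg s_le E0 E_le _ _.
  by apply: cvgM; exact: h.
have hr : (fun j => 2 * (N (D n j) * g 0%N) + 2 * (N (C n * E j) * N (D n j))) @ \oo -->
    2 * (rho n * g 0%N) + 2 * (s * u n * rho n).
  apply: cvgD; (apply: cvgM; first exact: cvg_cst); apply: cvgM;
    [exact: D_cvg|exact: cvg_cst|exact: CE_cvg|exact: D_cvg].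
apply: (ler_cvg_to hl hr); apply: nearW => j.
have h1 := toeplitz_CS psd (D n j) 'X^m.
have h2 := toeplitz_CS psd (C n * E j) ('X^m * D n j).
rewrite -[in X in _ <= X](mulr1 'X^m) toeplitzXn g0 in h1.
rewrite toeplitzXn in h2.
(* Write [g m] as the form of [1] and ['X^m] and insert [1 = D n j + C n * E j] in each argument in
   turn. *)
have -> : B (C n * E j) ('X^m * C n * E j) - g m =
    - (B (D n j) 'X^m + B (C n * E j) ('X^m * D n j)).
  have -> : g m = B (D n j + C n * E j) 'X^m by rewrite subrK toeplitz1Xn.
  have -> : 'X^m * D n j = 'X^m - 'X^m * C n * E j by rewrite /D; ring.
  by rewrite !toeplitz_lin; ring.
rewrite sqrrN; move: (B (D n j) _) (B _ ('X^m * D n j)) h1 h2 => a b h1 h2.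
by have := sqr_ge0 (a - b); nra.
Qed.

Lemma outer_factor_aux : exists A : nat -> {poly R}, toeplitz_cauchy kdelta A /\
  forall m, (fun n => I (A n) ('X^m * A n)) @ \oo --> g m.
Proof.
have ss : Num.sqrt s * Num.sqrt s = s.
  by rewrite -expr2 sqr_sqrtr// (le_trans _ s_ge1).
exists (fun n => Num.sqrt s *: C n); split.
  move=> e e0; have s0 : 0 < s by rewrite (lt_le_trans _ s_ge1).
  have [n hn] := cauchy_seq_of_cvg u_cvg (divr_gt0 e0 s0); exists n => i j ni nj.
  rewrite -scalerBr toeplitzZl toeplitzZr mulrA ss C_dist.
  by have := hn _ _ ni nj; rewrite ler_pdivlMr// mulrC.
move=> m; under eq_fun do rewrite -scalerAr toeplitzZl toeplitzZr mulrA ss.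
exact: correlation_cvg.
Qed.

End outer_factor.

(** Realizes [g] as the autocorrelation of a square summable sequence. The sequence is given by
    polynomials [A n], because polynomials are what acts on functions of a system. *)
Lemma outer_factor {R : realType} (g : nat -> R) :
  (forall p : {poly R}, toeplitz kdelta p p <= toeplitz g p p) ->
  (forall P : nat -> {poly R}, toeplitz_cauchy g P ->
    (fun j => toeplitz kdelta (P j) (P j)) @ \oo --> 0 ->
    (fun j => toeplitz g (P j) (P j)) @ \oo --> 0) ->
  exists A : nat -> {poly R}, toeplitz_cauchy kdelta A /\
    forall m, (fun n => toeplitz kdelta (A n) ('X^m * A n)) @ \oo --> g m.
Proof.
move=> dom closable.
have psd p : 0 <= toeplitz g p p.
  exact: le_trans (toeplitz_kdelta_ge0 p) (dom p).
have [s [E [s_le E0 E_le]]] := innovation psd.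
have [|c c_inv] := @inverse_series _ (fun k => lim ((fun j => (E j)`_k) @ \oo)).
  by under eq_fun do rewrite E0; exact: lim_cst.
exact: (@outer_factor_aux R g dom closable s E s_le E0 E_le c c_inv).
Qed.

(** * Completeness of L^2 and correlations *)

Section square_integrable.
Context {d : measure_display} {X : measurableType d} {R : realType}.
Variable mu : probability X R.
Implicit Types (f g h : X -> R) (a : R).

Local Notation L2 := (Lfun mu 2%:E).

Lemma L2_measurable f : f \in L2 -> measurable_fun setT f.
Proof. by move=> /andP[]; rewrite inE. Qed.

Lemma L2_of_integral f : measurable_fun setT f ->
  (\int[mu]_x (f x ^+ 2)%:E < +oo)%E -> f \in L2.
Proof.
move=> mf foo; rewrite inE; apply/andP; split; first by rewrite inE.
rewrite inE/= /finite_norm unlock poweR_lty//=.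
by under eq_integral do rewrite powR_mulrn// real_normK ?num_real//.
Qed.

Lemma L2_linear a f g : f \in L2 -> g \in L2 ->
  (fun x => a * f x + g x) \in L2.
Proof. exact: (Lfun_submod_closed mu (lee1n 2)).2. Qed.

Lemma L2_cst a : (fun=> a) \in L2.
Proof. exact: Lfun_cst. Qed.

Lemma L2B f g : f \in L2 -> g \in L2 -> (fun x => f x - g x) \in L2.
Proof.
move=> f2 g2; have -> : (fun x => f x - g x) = (fun x => -1 * g x + f x).
  by apply: boolp.funext => x; rewrite mulN1r addrC.
exact: L2_linear.
Qed.

Lemma L2_sum n (a : 'I_n -> R) (f : 'I_n -> X -> R) :
  (forall i, f i \in L2) -> (fun x => \sum_i a i * f i x) \in L2.
Proof.
elim: n a f => [|n IH] a f f2.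
  by under eq_fun do rewrite big_ord0; exact: L2_cst.
under eq_fun do rewrite big_ord_recl; apply: L2_linear => //.
exact: (IH (fun i => a (lift ord0 i)) (fun i => f (lift ord0 i))).
Qed.

Lemma L2M_integrable f g : f \in L2 -> g \in L2 ->
  mu.-integrable setT (fun x => (f x * g x)%:E).
Proof. by move=> f2 g2; apply/Lfun1_integrable/Lfun2_mul_Lfun1. Qed.

Lemma L2_integrable f : f \in L2 -> mu.-integrable setT (EFin \o f).
Proof.
move=> f2; have -> : EFin \o f = (fun x => (f x * 1)%:E).
  by apply: boolp.funext => x; rewrite /= mulr1.
exact: L2M_integrable (L2_cst 1).
Qed.

Definition ip f g : R := \int[mu]_x (f x * g x).

Lemma ipC f g : ip f g = ip g f.
Proof. by apply: eq_Rintegral => x _; rewrite mulrC. Qed.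

Lemma ip_ge0 f : 0 <= ip f f.
Proof. by apply: Rintegral_ge0 => x _; rewrite -expr2 sqr_ge0. Qed.

Lemma EFin_ip f g : f \in L2 -> g \in L2 ->
  (ip f g)%:E = (\int[mu]_x (f x * g x)%:E)%E.
Proof.
move=> f2 g2; rewrite /ip /Rintegral fineK//.
by apply: integrable_fin_num => //; exact: L2M_integrable.
Qed.

Lemma ip_linear a f g h : f \in L2 -> g \in L2 -> h \in L2 ->
  ip (fun x => a * f x + g x) h = a * ip f h + ip g h.
Proof.
move=> f2 g2 h2; rewrite /ip -RintegralZl//; last exact: L2M_integrable.
rewrite -RintegralD//; last 2 first.
- have -> : EFin \o (fun x => a * (f x * h x)) =
      (fun x => ((a * f x + 0) * h x)%:E).
    by apply: boolp.funext => x; rewrite /= addr0 mulrA.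
  by apply: L2M_integrable => //; exact: L2_linear (L2_cst 0).
- exact: L2M_integrable.
by apply: eq_Rintegral => x _; rewrite mulrDl mulrA.
Qed.

Lemma ipBl f g h : f \in L2 -> g \in L2 -> h \in L2 ->
  ip (fun x => f x - g x) h = ip f h - ip g h.
Proof.
move=> f2 g2 h2; rewrite -[RHS]addrC -mulN1r -ip_linear//.
by congr ip; apply: boolp.funext => x; rewrite mulN1r addrC.
Qed.

Lemma ipBr f g h : f \in L2 -> g \in L2 -> h \in L2 ->
  ip h (fun x => f x - g x) = ip h f - ip h g.
Proof. by move=> f2 g2 h2; rewrite ipC ipBl// !(ipC h). Qed.

Lemma ip0l g : ip (fun=> 0) g = 0.
Proof.
rewrite /ip; under eq_Rintegral do rewrite mul0r.
by rewrite Rintegral_cst// mul0r.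
Qed.

Lemma ip_suml n (a : 'I_n -> R) (f : 'I_n -> X -> R) h :
  (forall i, f i \in L2) -> h \in L2 ->
  ip (fun x => \sum_i a i * f i x) h = \sum_i a i * ip (f i) h.
Proof.
elim: n a f => [|n IH] a f f2 h2.
  by under [in LHS]eq_fun do rewrite big_ord0; rewrite ip0l big_ord0.
under [in LHS]eq_fun do rewrite big_ord_recl.
rewrite ip_linear//; last exact: (L2_sum (fun i => a (lift ord0 i))).
by rewrite big_ord_recl (IH (fun i => a (lift ord0 i)) (fun i => f (lift ord0 i))).
Qed.

Lemma ip_CS f g : f \in L2 -> g \in L2 -> ip f g ^+ 2 <= ip f f * ip g g.
Proof.
move=> f2 g2; apply: discriminant_le => [|t]; first exact: ip_ge0.
have -> : ip f f + 2 * t * ip f g + t ^+ 2 * ip g g =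
    ip (fun x => t * g x + f x) (fun x => t * g x + f x).
  rewrite ip_linear//; last exact: L2_linear.
  by rewrite !(ipC _ (fun x => t * g x + f x)) !ip_linear// (ipC g f); ring.
exact: ip_ge0.
Qed.

Lemma ip1 f : ip f (fun=> 1) = \int[mu]_x f x.
Proof. by apply: eq_Rintegral => x _; rewrite mulr1. Qed.

Lemma ip_cvg (f g : nat -> X -> R) F G :
  (forall n, f n \in L2) -> F \in L2 -> (forall n, g n \in L2) -> G \in L2 ->
  (fun n => ip (fun x => F x - f n x) (fun x => F x - f n x)) @ \oo --> 0 ->
  (fun n => ip (fun x => G x - g n x) (fun x => G x - g n x)) @ \oo --> 0 ->
  (fun n => ip (f n) (g n)) @ \oo --> ip F G.
Proof.
move=> f2 F2 g2 G2 fF gG.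
have Ff2 n : (fun x => F x - f n x) \in L2 by exact: L2B.
have Gg2 n : (fun x => G x - g n x) \in L2 by exact: L2B.
have -> : (fun n => ip (f n) (g n)) = (fun n => ip F G -
    ip (fun x => F x - f n x) G - ip F (fun x => G x - g n x) +
    ip (fun x => F x - f n x) (fun x => G x - g n x)).
  by apply: boolp.funext => n; rewrite !ipBl// !ipBr//; ring.
rewrite -[X in _ --> X]addr0; apply: cvgD; last first.
  apply: (cvg0_sqr (fun n => ip_CS (Ff2 n) (Gg2 n))).
  by rewrite -(mulr0 0); apply: cvgM.
rewrite -[X in _ --> X]subr0; apply: cvgB; last first.
  apply: (cvg0_sqr (fun n => ip_CS F2 (Gg2 n))).
  by rewrite -(mulr0 (ip F F)); apply: cvgM => //; exact: cvg_cst.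
rewrite -[X in _ --> X]subr0; apply: cvgB; first exact: cvg_cst.
apply: (cvg0_sqr (fun n => ip_CS (Ff2 n) G2)).
by rewrite -(mul0r (ip G G)); apply: cvgM => //; exact: cvg_cst.
Qed.

End square_integrable.

Section square_integrable_complete.
Context {d : measure_display} {X : measurableType d} {R : realType}.
Variable mu : probability X R.
Local Notation L2 := (Lfun mu 2%:E).

(** Cauchy-Schwarz against the constant 1, which has norm 1 for a probability measure. *)
Lemma ip_dist_le_integral_norm (f g : X -> R) (b : R) : 0 <= b ->
  f \in L2 -> g \in L2 ->
  ip mu (fun x => f x - g x) (fun x => f x - g x) <= b ^+ 2 ->
  (\int[mu]_x `|f x - g x|%:E <= b%:E)%E.
Proof.
move=> b0 f2 g2 fgb; have fg2 := L2B f2 g2.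
have nfg2 : (fun x => `|f x - g x|) \in L2.
  apply: L2_of_integral.
    by apply: measurableT_comp => //; exact: L2_measurable fg2.
  have /integrable_lty := L2M_integrable fg2 fg2; move=> /(_ measurableT).
  by under [in X in _ -> X]eq_integral do rewrite real_normK ?num_real// expr2.
have := EFin_ip nfg2 (L2_cst mu 1).
under eq_integral do rewrite mulr1.
move=> <-; rewrite lee_fin -(@ler_pXn2r _ 2)// ?nnegrE//; last first.
  by apply: Rintegral_ge0 => x _; rewrite mulr1.
apply: (le_trans (ip_CS nfg2 (L2_cst mu 1))).
have -> : ip mu (fun=> 1) (fun=> 1) = 1.
  rewrite ip1 Rintegral_cst// mul1r.
  exact: (congr1 fine (probability_setT mu)).
rewrite mulr1 (le_trans _ fgb)//.
rewrite (_ : ip _ _ _ = ip mu (fun x => f x - g x) (fun x => f x - g x))//.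
by apply: eq_Rintegral => x _; rewrite -!expr2 real_normK ?num_real.
Qed.

(* A fast subsequence converges almost everywhere, because the sum of its
   increments is integrable; Fatou's lemma upgrades this to the L^2 norm. *)
Lemma L2_complete (f : nat -> X -> R) : (forall n, f n \in L2) ->
  (forall e, 0 < e -> exists n, forall i j, (n <= i)%N -> (n <= j)%N ->
    ip mu (fun x => f i x - f j x) (fun x => f i x - f j x) <= e) ->
  exists F, F \in L2 /\
    (fun n => ip mu (fun x => F x - f n x) (fun x => F x - f n x)) @ \oo --> 0.
Proof.
move=> f2 fC.
(* A geometric sequence, so the increments of the subsequence have summable L^1 norms. *)
pose b (k : nat) : R := 2 / (2 ^ (k + 1))%:R.
have b_gt0 k : 0 < b k by rewrite divr_gt0// ltr0n expn_gt0.
have /boolp.choice[N HN] := fun k => fC _ (exprn_gt0 2 (b_gt0 k)).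
(* Adding all earlier thresholds makes [phi] monotone and at least [N k]; the summand [k] makes it
   unbounded. *)
pose phi k := (k + \sum_(l < k.+1) N l)%N.
have Nphi k : (N k <= phi k)%N.
  by rewrite /phi big_ord_recr/= addnA leq_addl.
have phiS k : (phi k <= phi k.+1)%N.
  by rewrite /phi [X in (_ <= _ + X)%N]big_ord_recr/=; lia.
pose h k := f (phi k).
pose D k x := h k.+1 x - h k x.
have D_int k : (\int[mu]_x `|D k x|%:E <= (b k)%:E)%E.
  apply: ip_dist_le_integral_norm; rewrite ?f2 ?(ltW (b_gt0 k))//.
  by apply: HN => //; exact: leq_trans (Nphi k) (phiS k).
have mh k : measurable_fun setT (h k) by apply: L2_measurable; exact: f2.
have mD k : measurable_fun setT (fun x => `|D k x|%:E).
  apply/measurable_EFinP; apply: measurableT_comp => //.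
  by apply: measurable_funB.
pose G x : \bar R := (\sum_(k <oo) `|D k x|%:E)%E.
have G0 x : (0 <= G x)%E by apply: nneseries_ge0 => k _ _; rewrite lee_fin.
have mG : measurable_fun setT G.
  by apply: ge0_emeasurable_sum => // k x _ _; rewrite lee_fin.
have iG : mu.-integrable setT G.
  apply/integrableP; split => //.
  under eq_integral do rewrite gee0_abs//.
  rewrite integral_nneseries//.
  apply: (@le_lt_trans _ _ (\sum_(k <oo) (b k)%:E)%E).
    by apply: lee_nneseries => // k _ _; apply: integral_ge0 => x _; rewrite lee_fin.
  by have /cvg_lim -> // := @cvg_geometric_eseries_half R 2 0; rewrite ltry.
have aeG := integrable_ae measurableT iG.
(* The upper limit is defined and measurable everywhere; [fine] sends its infinite values to 0, and
   these occur only on the null set where [G] is infinite. *)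
pose F x := fine (limn_esup (fun k => (h k x)%:E)).
have hF x : G x \is a fin_num -> h ^~ x @ \oo --> F x.
  move=> Gx.
  pose u : R^nat := D ^~ x.
  have : cvgn (series u).
    apply: normed_cvg.
    have -> : [normed series u] = (fun n => \sum_(0 <= k < n) `|D k x|) by [].
    apply: nondecreasing_is_cvgn.
      by apply/nondecreasing_seqP => n; rewrite big_nat_recr//= lerDl.
    exists (fine (G x)) => _ [n _ <-].
    rewrite -lee_fin fineK// -sumEFin.
    by apply: nneseries_lim_ge => k _ _; rewrite lee_fin.
  have -> : u = telescope (h ^~ x) by [].
  rewrite telescopeK => hx.
  have /cvg_ex[l hl] : cvgn (h ^~ x).
    have -> : h ^~ x = (fun n => (h n x - h 0%N x) + h 0%N x).
      by apply: boolp.funext => n; rewrite subrK.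
    by apply: is_cvgD; [exact: hx|exact: is_cvg_cst].
  have : (fun k => (h k x)%:E) @ \oo --> l%:E by apply: cvg_EFin => //; exact: nearW.
  by move=> /cvg_limn_einf_sup[_ El]; rewrite /F El.
have mF : measurable_fun setT F.
  apply: measurableT_comp => //; apply: measurable_fun_limn_esup => k.
  exact/measurable_EFinP.
have Fdist e : 0 < e -> exists n0, forall n, (n0 <= n)%N ->
    (\int[mu]_x ((F x - f n x) ^+ 2)%:E <= e%:E)%E.
  move=> /fC[n0 hn0]; exists n0 => n n0n.
  have mhf k : measurable_fun setT (fun x => ((h k x - f n x) ^+ 2)%:E).
    apply/measurable_EFinP/measurable_funX/measurable_funB => //.
    exact: L2_measurable.
  have hf0 k x : (0 <= ((h k x - f n x) ^+ 2)%:E)%E by rewrite lee_fin sqr_ge0.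
  (* Almost everywhere the square distance is the lower limit along the subsequence, whose integrals
     are at most [e] from [n0] on. *)
  apply: (@le_trans _ _ (\int[mu]_x limn_einf (fun k => ((h k x - f n x) ^+ 2)%:E))%E).
    apply: ae_ge0_le_integral => //.
    - by move=> x _; rewrite lee_fin sqr_ge0.
    - apply/measurable_EFinP/measurable_funX/measurable_funB => //.
      exact: L2_measurable.
    - move=> x _; rewrite limn_einf_lim; apply: lime_ge; first exact: is_cvg_einfs.
      by apply: nearW => k; apply: le_ereal_inf_tmp => _ [m _ <-].
    - rewrite [X in measurable_fun _ X](_ : _ =
        (fun x => - limn_esup (fun k => - ((h k x - f n x) ^+ 2)%:E))%E)//.
      apply: measurableT_comp => //; apply: measurable_fun_limn_esup => k.
      exact: measurableT_comp.
    - apply: filterS aeG => x Gx _.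
      have hx := hF x (Gx Logic.I).
      have : (fun k => ((h k x - f n x) ^+ 2)%:E) @ \oo --> ((F x - f n x) ^+ 2)%:E.
        apply: cvg_EFin; first exact: nearW.
        rewrite expr2; under eq_fun do rewrite /= expr2.
        by apply: cvgM; apply: cvgB => //; exact: cvg_cst.
      by move=> /cvg_limn_einf_sup[-> _].
  apply: (le_trans (fatou _ measurableT mhf (fun k x _ => hf0 k x))).
  rewrite limn_einf_lim; apply: lime_le; first exact: is_cvg_einfs.
  exists n0 => // k /= n0k.
  apply: (@le_trans _ _ (\int[mu]_x ((h k x - f n x) ^+ 2)%:E)%E).
    by apply: ereal_inf_lbound; exists k => /=.
  under eq_integral do rewrite expr2.
  rewrite -EFin_ip ?lee_fin; [|by apply: L2B; apply: f2|by apply: L2B; apply: f2].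
  by apply: hn0 => //; rewrite (leq_trans n0k)// leq_addr.
have FL2 : F \in L2.
  have [n0 /(_ n0 (leqnn _)) hn0] := Fdist 1 ltr01.
  have Ff2 : (fun x => F x - f n0 x) \in L2.
    apply: L2_of_integral; last exact: le_lt_trans hn0 (ltry _).
    by apply: measurable_funB => //; exact: L2_measurable.
  have -> : F = (fun x => 1 * (F x - f n0 x) + f n0 x).
    by apply: boolp.funext => x; rewrite mul1r subrK.
  exact: L2_linear.
exists F; split=> //; apply/cvgr0Pnorm_le => e /Fdist[n0 hn0].
exists n0 => // n /= /hn0; rewrite ger0_norm ?ip_ge0//.
under eq_integral do rewrite expr2.
by rewrite -EFin_ip ?lee_fin//; exact: L2B.
Qed.

End square_integrable_complete.

(** * Correlations of a measure preserving map *)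

Section measure_preserving_systems.
Context {d : measure_display} {X : measurableType d} {R : realType}.
Variable mu : probability X R.
Local Notation L2 := (Lfun mu 2%:E).
Implicit Types (T : X -> X) (f g : X -> R).

Lemma measure_preserving_iter T n :
  measure_preserving mu T -> measure_preserving mu (iter n T).
Proof.
move=> [mT hT]; elim: n => [|n [mTn hTn]]; first by split => //; exact: measurable_id.
split=> [|A mA]; first exact: (measurableT_comp mT mTn).
rewrite -(hT A)//; apply: (hTn (T @^-1` A)).
by rewrite -(setTI (_ @^-1` _)); exact: mT.
Qed.

Lemma measure_preserving_ge0_integral T (f : X -> \bar R) :
  measure_preserving mu T -> measurable_fun setT f -> (forall x, 0 <= f x)%E ->
  (\int[mu]_x f (T x) = \int[mu]_x f x)%E.
Proof.
move=> [mT hT] mf f0; transitivity (\int[pushforward mu T]_x f x)%E.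
  by rewrite ge0_integral_pushforward.
by apply: eq_measure_integral => A mA _; exact: hT.
Qed.

Lemma measure_preserving_integral T (f : X -> \bar R) :
  measure_preserving mu T -> measurable_fun setT f ->
  (\int[mu]_x f (T x) = \int[mu]_x f x)%E.
Proof.
move=> hT mf; rewrite integralE [RHS]integralE.
rewrite -[fun x => f (T x)]/(f \o T) funepos_comp funeneg_comp.
congr (_ - _)%E.
  by apply: (@measure_preserving_ge0_integral T f^\+%E) => //; exact: measurable_funepos.
by apply: (@measure_preserving_ge0_integral T f^\-%E) => //; exact: measurable_funeneg.
Qed.

Section system.
Variable T : X -> X.
Hypothesis hT : measure_preserving mu T.

Lemma L2_iter f n : f \in L2 -> (fun x => f (iter n T x)) \in L2.
Proof.
move=> f2; have hTn := measure_preserving_iter n hT; have mf := L2_measurable f2.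
apply: L2_of_integral; first exact: (measurableT_comp mf hTn.1).
rewrite (@measure_preserving_ge0_integral _ (fun x => (f x ^+ 2)%:E))//.
- by have /integrable_lty := Lfun2_integrable_sqr f2; apply.
- exact/measurable_EFinP/measurable_funX.
- by move=> x; rewrite lee_fin sqr_ge0.
Qed.

Lemma ip_iter f g n : f \in L2 -> g \in L2 ->
  ip mu (fun x => f (iter n T x)) (fun x => g (iter n T x)) = ip mu f g.
Proof.
move=> f2 g2; congr fine.
apply: (@measure_preserving_integral _ (fun x => (f x * g x)%:E)).
  exact: measure_preserving_iter.
by apply/measurable_EFinP/measurable_funM;
  [exact: L2_measurable f2|exact: L2_measurable g2].
Qed.

Lemma integral_iter f n : f \in L2 ->
  \int[mu]_x f (iter n T x) = \int[mu]_x f x.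
Proof. by move=> f2; rewrite -!ip1 -[RHS](ip_iter n f2 (L2_cst _ 1)). Qed.

Lemma ip_correlation f i j : f \in L2 ->
  ip mu (fun x => f (iter i T x)) (fun x => f (iter j T x)) =
  correlation mu T f ((i - j) + (j - i)).
Proof.
move=> f2; wlog ij : i j / (i <= j)%N => [hw|].
  by have [/hw//|/ltnW/hw] := leqP i j; rewrite ipC addnC.
rewrite (eqP ij) add0n -[RHS](ip_iter i)//; last exact: L2_iter.
by congr ip; apply: boolp.funext => x; rewrite -iterD subnK.
Qed.

Definition poly_act (p : {poly R}) f : X -> R :=
  fun x => \sum_(i < size p) p`_i * f (iter i T x).

Lemma poly_act_L2 p f : f \in L2 -> poly_act p f \in L2.
Proof.
move=> f2; apply: (@L2_sum _ _ _ mu (size p) (fun i => p`_i)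
  (fun i x => f (iter i T x))) => i; exact: L2_iter.
Qed.

(** The action on [f] turns the Toeplitz form of its correlations into the inner product and
    multiplication by ['X] into composition with [T]. By bilinearity it suffices to check
    monomials. *)
Lemma poly_act_ip p q f n : f \in L2 ->
  ip mu (poly_act p f) (fun x => poly_act q f (iter n T x)) =
  toeplitz (correlation mu T f) p ('X^n * q).
Proof.
move=> f2; have -> : (fun x => poly_act q f (iter n T x)) =
    (fun x => \sum_(j < size q) q`_j * f (iter (n + j) T x)).
  apply: boolp.funext => x; apply: eq_bigr => j _.
  by rewrite -iterD addnC.
rewrite /poly_act ip_suml; last 2 first.
- by move=> i; exact: L2_iter.
- apply: (@L2_sum _ _ _ mu (size q) (fun j => q`_j)
    (fun j x => f (iter (n + j) T x))) => j; exact: L2_iter.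
rewrite -[in RHS](coefK p) -[X in toeplitz _ _ (_ * X)](coefK q) !poly_def.
rewrite mulr_sumr toeplitz_suml.
apply: eq_bigr => i _; rewrite toeplitzZl ipC ip_suml; last 2 first.
- by move=> j; exact: L2_iter.
- exact: L2_iter.
congr (_ * _); rewrite toeplitz_sumr; apply: eq_bigr => j _.
by rewrite -scalerAr toeplitzZr -exprD toeplitz_monom ipC ip_correlation.
Qed.

Lemma poly_act_ip0 p q f : f \in L2 ->
  ip mu (poly_act p f) (poly_act q f) = toeplitz (correlation mu T f) p q.
Proof. by move=> f2; have := poly_act_ip p q 0 f2; rewrite mul1r. Qed.

Lemma correlation_psd f (p : {poly R}) : f \in L2 ->
  0 <= toeplitz (correlation mu T f) p p.
Proof. by move=> f2; rewrite -poly_act_ip0// ip_ge0. Qed.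

Lemma poly_act_integral p f : f \in L2 -> \int[mu]_x f x = 0 ->
  \int[mu]_x poly_act p f x = 0.
Proof.
move=> f2 f0; rewrite -ip1 /poly_act ip_suml; last 2 first.
- by move=> i; exact: L2_iter.
- exact: L2_cst.
by rewrite big1// => i _; rewrite ip1 integral_iter// f0 mulr0.
Qed.

(** Transports constructions from polynomials to the system: the action on [f] is isometric, so a
    Cauchy sequence of polynomials yields a limit in L^2, and both the mean and the correlations
    pass to the limit. *)
Lemma toeplitz_cauchy_limit f (A : nat -> {poly R}) (c : nat -> R) :
  f \in L2 -> \int[mu]_x f x = 0 -> toeplitz_cauchy (correlation mu T f) A ->
  (forall m, (fun n => toeplitz (correlation mu T f) (A n) ('X^m * A n)) @ \oo
    --> c m) ->
  exists F, [/\ F \in L2, \int[mu]_x F x = 0 &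
    forall m, correlation mu T F m = c m].
Proof.
move=> f2 f0 AC Ac; pose a n := poly_act (A n) f.
have a2 n : a n \in L2 by exact: poly_act_L2.
have [|F [F2 aF]] := L2_complete a2.
  move=> e /AC[n hn]; exists n => i j ni nj; apply: le_trans (hn i j ni nj).
  by rewrite !ipBl ?ipBr ?poly_act_ip0// ?L2B// !toeplitz_lin; lra.
exists F; split=> //.
  rewrite -ip1; have h : (fun n => ip mu (a n) (fun=> 1)) @ \oo --> ip mu F (fun=> 1).
    apply: ip_cvg => //; try (move=> *; exact: L2_cst).
    under eq_fun do under [X in ip _ X _]eq_fun do rewrite subrr.
    by under eq_fun do rewrite ip0l; exact: cvg_cst.
  have /cvg_lim <- // := h.
  under eq_fun do rewrite ip1 poly_act_integral//.
  exact: lim_cst.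
move=> m; have h : (fun n => ip mu (a n) (fun x => a n (iter m T x))) @ \oo -->
    ip mu F (fun x => F (iter m T x)).
  apply: ip_cvg => //; [by move=> n; exact: L2_iter|exact: L2_iter|].
  under eq_fun => n do rewrite (ip_iter m (L2B F2 (a2 n)) (L2B F2 (a2 n))).
  exact: aF.
rewrite -[LHS]/(ip mu F (fun x => F (iter m T x))).
have /cvg_lim <- // := h; apply: cvg_lim => //.
by under eq_fun do rewrite poly_act_ip//; exact: Ac.
Qed.

End system.
End measure_preserving_systems.

(** * Toeplitz forms of densities on the torus *)

(** Integrability is part of the conclusion so that the lemma can be applied again to an outer
    sum. *)
Lemma Rintegral_sum {d} {T : measurableType d} {R : realType}
    (mu : {measure set T -> \bar R}) (D : set T) n (a : 'I_n -> R)
    (F : 'I_n -> T -> R) : measurable D ->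
  (forall i, mu.-integrable D (EFin \o F i)) ->
  mu.-integrable D (EFin \o (fun t => \sum_i a i * F i t)) /\
  \int[mu]_(t in D) (\sum_i a i * F i t) = \sum_i a i * \int[mu]_(t in D) F i t.
Proof.
move=> mD; elim: n a F => [|n IH] a F iF.
  have h0 : (fun t : T => \sum_(i < 0) a i * F i t) = fun=> 0.
    by apply: boolp.funext => t; rewrite big_ord0.
  rewrite h0 big_ord0; split; first exact: integrable0.
  by rewrite /Rintegral integral0.
have iF0 : mu.-integrable D (EFin \o (fun t => a ord0 * F ord0 t)).
  by have := integrableZl mD (a ord0) (iF ord0).
have [i1 e1] := IH (fun i => a (lift ord0 i)) _ (fun i => iF (lift ord0 i)).
have h : (fun t => \sum_i a i * F i t) = (fun t => a ord0 * F ord0 t +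
    \sum_i a (lift ord0 i) * F (lift ord0 i) t).
  by apply: boolp.funext => t; rewrite big_ord_recl.
rewrite h big_ord_recl -e1; split; first exact: (integrableD mD iF0 i1).
by rewrite RintegralD// RintegralZl.
Qed.

Section torus_forms.
Context {R : realType}.
Local Notation mu := (@lebesgue_measure R).
Implicit Types (w : R -> R) (p : {poly R}).

Definition cosn (t : R) (n : nat) : R := cos (2 * pi * n%:R * t).

(** The value is the square modulus of [p] at [exp (2 pi i t)], split below into its real part [c]
    and imaginary part [s]. *)
Lemma toeplitz_cosn_ge0 t p : 0 <= toeplitz (cosn t) p p.
Proof.
have cosn_dist i j : cosn t ((i - j) + (j - i)) =
    cos (2 * pi * i%:R * t) * cos (2 * pi * j%:R * t) +
    sin (2 * pi * i%:R * t) * sin (2 * pi * j%:R * t).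
  wlog ij : i j / (j <= i)%N => [hw|].
    have [/hw//|/ltnW/hw] := leqP j i; rewrite addnC => ->.
    by rewrite [X in X + _]mulrC [X in _ + X]mulrC.
  rewrite (eqP ij) addn0 /cosn natrB// -cosB; congr cos; ring.
pose c := \sum_(i < size p) p`_i * cos (2 * pi * i%:R * t).
pose s := \sum_(i < size p) p`_i * sin (2 * pi * i%:R * t).
suff -> : toeplitz (cosn t) p p = c ^+ 2 + s ^+ 2 by rewrite addr_ge0// sqr_ge0.
rewrite !expr2 /c /s !mulr_suml -big_split/=; apply: eq_bigr => i _.
rewrite !mulr_sumr -big_split/=; apply: eq_bigr => j _.
by rewrite cosn_dist; ring.
Qed.

Lemma measurable_torus : measurable (@torus R).
Proof. exact: measurable_itv. Qed.

Lemma cos_integrable w n : mu.-integrable torus (EFin \o w) ->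
  mu.-integrable torus (EFin \o (fun t => w t * cosn t n)).
Proof.
move=> iw; have -> : EFin \o (fun t => w t * cosn t n) =
    ((EFin \o w) \* (EFin \o cosn ^~ n))%E by [].
apply: integrableMl iw _ _; first exact: measurable_torus.
  apply: measurable_funTS; apply: continuous_measurable_fun => t.
  apply: continuous_comp; last exact: continuous_cos.
  by apply: continuousM; [exact: cst_continuous|exact: cvg_id].
exists 1; split=> // M M1 t _ /=; rewrite (le_trans (cos_max _))// ltW//.
Qed.

(** The real part of [fourier_coef], which keeps the Toeplitz forms real. *)
Definition cosine_coef w n : R := \int[mu]_(t in torus) (w t * cosn t n).

(** The form is the square norm of [p] on the unit circle with weight [w]; positivity and
    monotonicity in [w] follow. *)
Lemma toeplitz_cosine_coef w p : mu.-integrable torus (EFin \o w) ->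
  mu.-integrable torus (EFin \o (fun t => w t * toeplitz (cosn t) p p)) /\
  toeplitz (cosine_coef w) p p =
  \int[mu]_(t in torus) (w t * toeplitz (cosn t) p p).
Proof.
move=> iw; pose k (i j : nat) := ((i - j) + (j - i))%N.
have hF (i : 'I_(size p)) := @Rintegral_sum _ _ _ mu torus _
  (fun j : 'I_(size p) => p`_j) _ measurable_torus
  (fun j : 'I_(size p) => cos_integrable (k i j) iw).
have [h1 h2] := @Rintegral_sum _ _ _ mu torus _ (fun i : 'I_(size p) => p`_i)
  _ measurable_torus (fun i : 'I_(size p) => (hF i).1).
have -> : (fun t => w t * toeplitz (cosn t) p p) =
    (fun t => \sum_(i < size p) p`_i * (\sum_(j < size p) p`_j *
      (w t * cosn t (k i j)))).
  apply: boolp.funext => t; rewrite mulr_sumr; apply: eq_bigr => i _.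
  rewrite !mulr_sumr; apply: eq_bigr => j _; rewrite /k; ring.
split; first exact: h1.
rewrite h2; apply: eq_bigr => i _; rewrite (hF i).2 mulr_sumr.
by apply: eq_bigr => j _; rewrite mulrA.
Qed.

Lemma lebesgue_measure_torus : mu (@torus R) = 1%E.
Proof. by rewrite /torus lebesgue_measure_itv/= lte01 oppr0 adde0. Qed.

Lemma bounded_torus_integrable w (M : R) : measurable_fun torus w ->
  (forall t, `|w t| <= M) -> mu.-integrable torus (EFin \o w).
Proof.
move=> mw wM; apply: measurable_bounded_integrable => //.
- exact: measurable_torus.
- by rewrite [ltLHS]lebesgue_measure_torus ltry.
- exists M; split; first exact: num_real.
  by move=> x Mx t _ /=; rewrite (le_trans (wM t))// ltW.
Qed.

Lemma sin_2pin n : sin (2 * pi * n%:R) = 0 :> R.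
Proof.
elim: n => [|n IH]; first by rewrite mulr0 sin0.
have -> : 2 * pi * n.+1%:R = 2 * pi * n%:R + pi *+ 2 :> R.
  by rewrite -natr1 -mulr_natl; ring.
by rewrite sinD IH mul0r add0r sin2pi mulr0.
Qed.

Lemma cos_2pin n : cos (2 * pi * n%:R) = 1 :> R.
Proof.
elim: n => [|n IH]; first by rewrite mulr0 cos0.
have -> : 2 * pi * n.+1%:R = 2 * pi * n%:R + pi *+ 2 :> R.
  by rewrite -natr1 -mulr_natl; ring.
by rewrite cosD IH mul1r cos2pi sin2pi mulr0 subr0.
Qed.

Lemma integral_torus_derivative (F f : R -> R) :
  (forall x : R, is_derive x 1 F (f x)) -> continuous f ->
  (exists M, forall t, `|f t| <= M) ->
  \int[mu]_(t in torus) f t = F 1 - F 0.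
Proof.
move=> dF cf [M fM]; have cF : continuous F.
  by move=> x; apply: differentiable_continuous; apply/derivable1_diffP.
rewrite /torus Rintegral_itv_bndo_bndc; last first.
  apply: (bounded_torus_integrable _ fM).
  by apply: measurable_funTS; exact: continuous_measurable_fun.
rewrite /Rintegral (@continuous_FTC2 _ _ F)//.
- exact: continuous_subspaceT.
- split; first by move=> x _; exact: ex_derive.
    by apply: cvg_at_right_filter; exact: cF.
  by apply: cvg_at_left_filter; exact: cF.
- by move=> x _; rewrite derive1E derive_val.
Qed.

Lemma integral_cosn_torus n : \int[mu]_(t in torus) cosn t n = kdelta n.
Proof.
case: n => [|n].
  rewrite (@eq_Rintegral _ _ _ mu torus (cst 1)); last first.
    by move=> t _; rewrite /cosn mulr0 mul0r cos0.
  rewrite Rintegral_cst; last exact: measurable_torus.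
  by rewrite mul1r [X in fine X]lebesgue_measure_torus.
pose k : R := 2 * pi * n.+1%:R.
have k0 : k != 0 by rewrite !mulf_neq0// gt_eqF// pi_gt0.
pose F : R -> R := k^-1 \*: (sin \o (k \*: id)).
transitivity (F 1 - F 0); last first.
  by rewrite /F /= /GRing.scale/= mulr0 sin0 mulr0 mulr1 sin_2pin mulr0 subr0.
apply: integral_torus_derivative.
- move=> x; apply: is_derive_eq; rewrite /GRing.scale/= mulr1.
  by rewrite mulrCA mulVf// mulr1.
- move=> x; apply: continuous_comp; last exact: continuous_cos.
  by apply: continuousM; [exact: cst_continuous|exact: cvg_id].
- by exists 1 => t; exact: cos_max.
Qed.

Lemma integral_sinn_torus n : \int[mu]_(t in torus) sin (2 * pi * n%:R * t) = 0.
Proof.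
case: n => [|n].
  rewrite (@eq_Rintegral _ _ _ mu torus (cst 0)); last first.
    by move=> t _; rewrite mulr0 mul0r sin0.
  by rewrite Rintegral_cst ?mul0r//; exact: measurable_torus.
pose k : R := 2 * pi * n.+1%:R.
have k0 : k != 0 by rewrite !mulf_neq0// gt_eqF// pi_gt0.
pose F : R -> R := (- k^-1) \*: (cos \o (k \*: id)).
transitivity (F 1 - F 0); last first.
  by rewrite /F /= /GRing.scale/= mulr0 cos0 mulr1 cos_2pin mulr1 subrr.
apply: integral_torus_derivative.
- move=> x; apply: is_derive_eq; rewrite /GRing.scale/= mulr1.
  by rewrite mulNr mulNr mulrN opprK mulrCA mulVf// mulr1.
- move=> x; apply: continuous_comp; last exact: continuous_sin.
  by apply: continuousM; [exact: cst_continuous|exact: cvg_id].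
- by exists 1 => t; exact: sin_max.
Qed.

Lemma integrable_torus_cst (c : R) : mu.-integrable torus (EFin \o cst c).
Proof.
by apply: (bounded_torus_integrable (M := `|c|)); first exact: measurable_cst.
Qed.

Lemma cosn_integrable n : mu.-integrable torus (EFin \o cosn ^~ n).
Proof.
apply: (bounded_torus_integrable (M := 1)); last by move=> t; exact: cos_max.
apply: measurable_funTS; apply: continuous_measurable_fun => t.
apply: continuous_comp; last exact: continuous_cos.
by apply: continuousM; [exact: cst_continuous|exact: cvg_id].
Qed.

Lemma sinn_integrable n :
  mu.-integrable torus (EFin \o (fun t => sin (2 * pi * n%:R * t))).
Proof.
apply: (bounded_torus_integrable (M := 1)); last by move=> t; exact: sin_max.
apply: measurable_funTS; apply: continuous_measurable_fun => t.
apply: continuous_comp; last exact: continuous_sin.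
by apply: continuousM; [exact: cst_continuous|exact: cvg_id].
Qed.

Lemma cosine_coef_cst (c : R) n : cosine_coef (cst c) n = c * kdelta n.
Proof.
rewrite /cosine_coef RintegralZl ?integral_cosn_torus//.
  exact: measurable_torus.
exact: cosn_integrable.
Qed.

Lemma toeplitz_cosine_coef_le w w' p :
  mu.-integrable torus (EFin \o w) -> mu.-integrable torus (EFin \o w') ->
  (forall t, torus t -> w t <= w' t) ->
  toeplitz (cosine_coef w) p p <= toeplitz (cosine_coef w') p p.
Proof.
move=> iw iw' ww'.
have [h1 ->] := toeplitz_cosine_coef p iw.
have [h2 ->] := toeplitz_cosine_coef p iw'.
apply: le_Rintegral => //; first exact: measurable_torus.
by move=> t /ww' wt; rewrite ler_wpM2r// toeplitz_cosn_ge0.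
Qed.

Lemma toeplitz_cosine_coef_ge0 w p : mu.-integrable torus (EFin \o w) ->
  (forall t, torus t -> 0 <= w t) -> 0 <= toeplitz (cosine_coef w) p p.
Proof.
move=> iw w0; have [_ ->] := toeplitz_cosine_coef p iw.
by apply: Rintegral_ge0 => t /w0 wt; rewrite mulr_ge0// toeplitz_cosn_ge0.
Qed.

Lemma toeplitz_weight_linear (a : R) (g h : nat -> R) p q :
  toeplitz (fun n => a * g n + h n) p q = a * toeplitz g p q + toeplitz h p q.
Proof.
rewrite mulr_sumr -big_split/=; apply: eq_bigr => i _.
by rewrite mulr_sumr -big_split/=; apply: eq_bigr => j _; ring.
Qed.

(** * Closability by truncation of the density *)

Section truncation.
Variable w : R -> R.
Hypothesis iw : mu.-integrable torus (EFin \o w).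
Hypothesis w0 : forall t, torus t -> 0 <= w t.

Let wM (M : nat) t := Num.min (w t) M%:R.

Let wM0 M t : torus t -> 0 <= wM M t.
Proof. by move=> /w0 wt; rewrite le_min wt ler0n. Qed.

Let mw : measurable_fun torus w.
Proof. by apply/measurable_EFinP; exact: measurable_int iw. Qed.

Let iwM M : mu.-integrable torus (EFin \o wM M).
Proof.
apply: le_integrable iw; first exact: measurable_torus.
  by apply/measurable_EFinP; apply: measurable_minr => //; exact: measurable_cst.
by move=> t tt; rewrite /= lee_fin !ger0_norm ?w0 ?wM0// ge_min lexx.
Qed.

Let cosine_coef_wM_cvg n : (fun M => cosine_coef (wM M) n) @ \oo --> cosine_coef w n.
Proof.
have h1 M := cos_integrable n (iwM M).
have h2 := cos_integrable n iw.
have := @dominated_convergence _ _ R mu torus measurable_torus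
  (fun M t => (wM M t * cosn t n)%:E) (fun t => (w t * cosn t n)%:E) (EFin \o w)
  (fun M => measurable_int _ (h1 M)) (measurable_int _ h2) _ iw _.
case.
- apply: aeW => t tt; apply: cvg_EFin; first exact: nearW.
  apply: cvgM; last exact: cvg_cst.
  apply/cvgrPdist_le => e e0; exists (Num.truncn (w t)).+1 => // M /= hM.
  rewrite /wM min_l ?subrr ?normr0 ?(ltW e0)//.
  by rewrite (le_trans (ltW (truncnS_gt _)))// ler_nat.
- apply: aeW => t M tt; rewrite /= lee_fin normrM.
  rewrite ger0_norm ?wM0// -[leRHS]mulr1 ler_pM ?wM0 ?cos_max//.
  by rewrite ge_min lexx.
move=> _ _ h; rewrite /cosine_coef /Rintegral.
apply: fine_cvg; rewrite fineK//; apply: integrable_fin_num => //.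
exact: measurable_torus.
Qed.

Let toeplitz_wM_cvg p :
  (fun M => toeplitz (cosine_coef (wM M)) p p) @ \oo --> toeplitz (cosine_coef w) p p.
Proof.
apply: cvg_sumr => i; apply: cvg_sumr => j; apply: cvgM; first exact: cvg_cst.
exact: cosine_coef_wM_cvg.
Qed.

(* For a bounded density the claim is immediate, and truncating [w] only loses a
   uniformly small part of a Cauchy sequence. *)
Lemma cosine_coef_closable (P : nat -> {poly R}) :
  toeplitz_cauchy (fun n => 1 * kdelta n + cosine_coef w n) P ->
  (fun j => toeplitz kdelta (P j) (P j)) @ \oo --> 0 ->
  (fun j => toeplitz (fun n => 1 * kdelta n + cosine_coef w n) (P j) (P j)) @ \oo --> 0.
Proof.
move=> PC P0; apply/cvgr0Pnorm_le => e e0.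
have [n hn] := PC _ (divr_gt0 e0 (ltr0Sn R 3)).
have [n' hn'] := cvg0_near P0 (divr_gt0 e0 (ltr0Sn R 1)).
exists (maxn n n') => // j /=; rewrite geq_max => /andP[nj /hn' hj].
rewrite toeplitz_weight_linear mul1r.
have I0 := toeplitz_kdelta_ge0 (P j); rewrite ger0_norm// in hj.
have c0 := toeplitz_cosine_coef_ge0 (P j) iw w0.
rewrite ger0_norm ?addr_ge0//.
suff : toeplitz (cosine_coef w) (P j) (P j) <= e / 2 by lra.
(* The bound is proved for each truncation height [M], with a constant independent of [M]. *)
apply: (cvgr_to_le (@toeplitz_wM_cvg (P j))); apply: nearW => M.
have lim_k : (fun k => e / 2 + 2 * M%:R * toeplitz kdelta (P k) (P k)) @ \oo --> e / 2.
  rewrite -[X in _ --> X]addr0; apply: cvgD; first exact: cvg_cst.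
  by rewrite -(mulr0 (2 * M%:R)); apply: cvgM; [exact: cvg_cst|exact: P0].
(* For fixed [M], split [P j] as [(P j - P k) + P k]. The first part is small by the Cauchy
   property, and the second is at most [M] times a standard norm that vanishes as [k] grows. *)
apply: (cvgr_to_ge lim_k); exists n => // k /= nk.
have psd (p : {poly R}) : 0 <= toeplitz (cosine_coef (wM M)) p p.
  by apply: toeplitz_cosine_coef_ge0 (iwM M) _ => t; exact: wM0.
have h1 := toeplitz_normD psd (P j - P k) (P k); rewrite subrK in h1.
have h2 : toeplitz (cosine_coef (wM M)) (P j - P k) (P j - P k) <= e / 4.
  apply: le_trans (hn j k nj nk); rewrite toeplitz_weight_linear mul1r.
  rewrite -[leLHS]add0r lerD ?toeplitz_kdelta_ge0//.
  by apply: toeplitz_cosine_coef_le => // t _; rewrite ge_min lexx.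
have h3 : toeplitz (cosine_coef (wM M)) (P k) (P k) <=
    M%:R * toeplitz kdelta (P k) (P k).
  have -> : M%:R * toeplitz kdelta (P k) (P k) =
      toeplitz (cosine_coef (cst M%:R)) (P k) (P k).
    have -> : cosine_coef (cst M%:R) = (fun n => M%:R * kdelta n + 0).
      by apply: boolp.funext => m; rewrite cosine_coef_cst addr0.
    rewrite toeplitz_weight_linear [X in _ + X]big1 ?addr0// => i _.
    by rewrite big1// => l _; rewrite mulr0.
  apply: toeplitz_cosine_coef_le => //.
    exact: integrable_torus_cst.
  by move=> t _; rewrite /= ge_min lexx orbT.
lra.
Qed.

(** The sequence factored is that of the density [1 + w]; the factor [1 *] gives it the shape of
    [toeplitz_weight_linear]. *)
Lemma cosine_coef_factor : exists A : nat -> {poly R}, toeplitz_cauchy kdelta A /\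
  forall m, (fun n => toeplitz kdelta (A n) ('X^m * A n)) @ \oo
    --> 1 * kdelta m + cosine_coef w m.
Proof.
apply: outer_factor cosine_coef_closable => p.
by rewrite toeplitz_weight_linear mul1r lerDl toeplitz_cosine_coef_ge0.
Qed.

End truncation.
End torus_forms.

(** * The equivalence *)

Section normalizations.
Context {d : measure_display} {X : measurableType d} {R : realType}.
Variable mu : probability X R.
Local Notation L2 := (Lfun mu 2%:E).

Lemma ip_eq0 (f : X -> R) : f \in L2 ->
  ip mu f f = 0 <-> ae_eq mu setT f (cst 0).
Proof.
move=> f2; have i2 := L2M_integrable f2 f2.
have m2 := measurable_int _ i2.
have abs_ff : (\int[mu]_x `|(f x * f x)%:E| = (ip mu f f)%:E)%E.
  rewrite EFin_ip//; apply: eq_integral => x _; rewrite gee0_abs//.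
  by rewrite lee_fin -expr2 sqr_ge0.
have [ae0 ae1] := ae_eq_integral_abs mu measurableT m2.
split=> [f0|f0].
  have := ae0 _; rewrite abs_ff f0 => /(_ erefl); apply: filterS => x /= h _.
  by have [/eqP] := h Logic.I; rewrite mulf_eq0 orbb => /eqP.
apply: EFin_inj; rewrite -abs_ff; apply: ae1.
by apply: filterS f0 => x /= h _; rewrite h// mulr0.
Qed.

Lemma integral_ae_cst (f : X -> R) c : f \in L2 -> ae_eq mu setT f (cst c) ->
  \int[mu]_x f x = c.
Proof.
move=> f2 fc; rewrite /Rintegral (@ae_eq_integral _ _ _ mu setT (EFin \o cst c))//.
- rewrite /= integral_cst//= (_ : mu _ = 1%E) ?mule1//.
  exact: probability_setT.
- by apply/measurable_EFinP; exact: L2_measurable f2.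
- by apply/measurable_EFinP; exact: measurable_cst.
- by apply: filterS fc => x /= h /h ->.
Qed.

Lemma nonconstant_centered (f : X -> R) : f \in L2 -> nonconstant mu f ->
  0 < ip mu (fun x => f x - \int[mu]_x f x) (fun x => f x - \int[mu]_x f x).
Proof.
move=> f2 fnc; rewrite lt_def ip_ge0 andbT; apply/eqP => /ip_eq0 h.
apply: fnc; exists (\int[mu]_x f x); have := h (L2B f2 (L2_cst mu _)).
by apply: filterS => x /= hx /hx /eqP; rewrite subr_eq0 => /eqP.
Qed.

Lemma Lnorm2_eq1 (f : X -> R) : f \in L2 ->
  Lnorm mu 2%:E (EFin \o f) = 1%E <-> ip mu f f = 1.
Proof.
move=> f2; have n2 : (Lnorm mu 2%:E (EFin \o f) `^ 2 = (ip mu f f)%:E)%E.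
  rewrite poweR_Lnorm// EFin_ip//; apply: eq_integral => x _ /=.
  by rewrite powR_mulrn// real_normK ?num_real// expr2.
have n0 := Lnorm_ge0 mu 2%:E (EFin \o f).
split=> [h|h]; first by move: n2; rewrite h poweR_EFin powR1 => -[].
move: n2 n0; rewrite h; case: (Lnorm _ _ _) => [r||//].
  rewrite poweR_EFin => -[/eqP] + r0; rewrite powR_mulrn// => r1.
  move: r1; rewrite sqrf_eq1 => /orP[/eqP->//|/eqP r1].
  by move: r0; rewrite r1 lee_fin ler0N1.
by rewrite poweRyr.
Qed.

End normalizations.

(** * The implications between the four properties *)

Section implications.
Context {d : measure_display} {X : measurableType d} {R : realType}.
Variables (mu : probability X R) (T : X -> X).
Hypothesis hT : measure_preserving mu T.
Local Notation L2 := (Lfun mu 2%:E).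
Local Notation leb := (@lebesgue_measure R).

Lemma correlation0 (f : X -> R) : correlation mu T f 0 = ip mu f f.
Proof. by []. Qed.

(** Test the sum of the first [n] iterates against the constant 1: Cauchy-Schwarz gives
    [(n m)^2 <= n] for the mean [m], for every [n]. *)
Lemma orthonormal_integral (f : X -> R) : f \in L2 ->
  correlation mu T f = kdelta -> \int[mu]_x f x = 0.
Proof.
move=> f2 fC; set m := \int[mu]_x f x.
have h n : n%:R * m ^+ 2 <= 1.
  case: n => [|n]; first by rewrite mul0r ler01.
  pose p : {poly R} := \poly_(k < n.+1) 1.
  have := ip_CS (poly_act_L2 hT p f2) (L2_cst mu 1).
  have sp : size p = n.+1 by rewrite size_poly_eq// oner_eq0.
  rewrite poly_act_ip0// fC kdelta_norm_poly.
  have -> : \sum_(k < n.+1) (1 : R) ^+ 2 = n.+1%:R.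
    by under eq_bigr do rewrite expr1n; rewrite sumr_const card_ord.
  rewrite [ip _ (fun=> 1) _]ip1 Rintegral_cst// mul1r.
  rewrite [X in fine X](probability_setT mu) mulr1 /poly_act ip_suml; last 2 first.
  - by move=> i; exact: L2_iter.
  - exact: L2_cst.
  have -> : \sum_(i < size p) p`_i * ip mu (fun x => f (iter i T x)) (fun=> 1) =
      n.+1%:R * m.
    rewrite (eq_bigr (fun=> m)) => [|i _]; last first.
      by rewrite ip1 integral_iter// coef_poly -sp ltn_ord mul1r.
    by rewrite sumr_const card_ord sp mulr_natl.
  rewrite exprMn expr2 -mulrA -[leRHS]mulr1 ler_pM2l ?ltr0n//.
have [//|m0] := eqVneq m 0.
have m2 : 0 < m ^+ 2 by rewrite lt_def sqrf_eq0 m0 sqr_ge0.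
have := h (Num.truncn (m ^+ 2)^-1).+1.
by rewrite leNgt -ltr_pdivrMr// mul1r truncnS_gt.
Qed.

Lemma Lebesgue_componentP : has_Lebesgue_component mu T <->
  exists f, [/\ f \in L2, \int[mu]_x f x = 0 & correlation mu T f = kdelta].
Proof.
split=> [[f [f2 /(Lnorm2_eq1 f2) f1 fC]]|[f [f2 _ fC]]].
  have fE : correlation mu T f = kdelta.
    by apply: boolp.funext => -[|n]; [rewrite correlation0 f1|rewrite fC].
  by exists f; split=> //; exact: orthonormal_integral.
exists f; split=> //; first by apply/Lnorm2_eq1 => //; rewrite -correlation0 fC.
by move=> [|n]// _; rewrite fC.
Qed.

(* The Lebesgue component is the normalized innovation of the centred function,
   that is, its component orthogonal to its forward iterates. *)
Lemma under_recurrent_Lebesgue (f : X -> R) :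
  under_recurrent mu T f -> has_Lebesgue_component mu T.
Proof.
move=> [f2 fnc fC]; set m := \int[mu]_x f x.
pose g x := f x - m.
have g2 : g \in L2 by exact: L2B (L2_cst mu m).
have cst2 := L2_cst mu (m : R).
have ip_m (h : X -> R) : h \in L2 -> ip mu h (fun=> m) = m * \int[mu]_x h x.
  move=> h2; rewrite /ip; under eq_Rintegral do rewrite mulrC.
  by rewrite RintegralZl//; exact: L2_integrable.
have int_m : \int[mu]_x m = m.
  by rewrite Rintegral_cst// [X in fine X](probability_setT mu) mulr1.
have g0 : \int[mu]_x g x = 0.
  by rewrite RintegralB// ?int_m ?subrr//; exact: L2_integrable.
(* Centring subtracts the square of the mean from every correlation, so under-recurrence becomes
   nonpositivity of the correlations of [g]. *)
have gC n : correlation mu T g n = correlation mu T f n - m ^+ 2.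
  have fn2 := L2_iter hT n f2.
  have fnm2 : (fun x => f (iter n T x) - m) \in L2 by exact: L2B.
  have int0 : \int[mu]_x (f (iter n T x) - m) = 0.
    by rewrite RintegralB ?int_m ?integral_iter ?subrr//; exact: L2_integrable.
  rewrite -[LHS]/(ip mu (fun x => f x - m) (fun x => f (iter n T x) - m)).
  by rewrite ipBl// ipBr// ip_m// [ip _ (fun=> m) _]ipC ip_m// int0 mulr0 subr0.
have psd p := correlation_psd hT p g2.
have gle n : (0 < n)%N -> correlation mu T g n <= 0.
  by move=> n0; rewrite gC subr_le0 fC.
have [s [E [s_le E0 E_le]]] := innovation psd.
have g00 : 0 < correlation mu T g 0 by exact: nonconstant_centered.
have s0 : 0 < s.
  apply: (lt_le_trans (divr_gt0 g00 (ltr0Sn R 1))).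
  apply: (cvgr_to_ge (innovation_cvg s_le E0 E_le)); apply: nearW => j.
  exact: nonpos_correlation_innovation.
have ss : (Num.sqrt s)^-1 * (Num.sqrt s)^-1 = s^-1.
  by rewrite -invfM -expr2 sqr_sqrtr// ltW.
apply/Lebesgue_componentP.
have [||F [F2 F0 FC]] := @toeplitz_cauchy_limit _ _ _ mu T hT g
  (fun j => (Num.sqrt s)^-1 *: E j) kdelta g2 g0.
- move=> e e0; have [n hn] := cvg0_near (@cvg_harmonic R)
    (divr_gt0 (mulr_gt0 e0 s0) (ltr0Sn R 3)).
  exists n => i j /hn hi /hn hj.
  rewrite -scalerBr toeplitzZl toeplitzZr mulrA ss mulrC ler_pdivrMr//.
  rewrite (le_trans (innovation_dist s_le E0 E_le _ _))//.
  have := le_trans (ler_norm _) hi; have := le_trans (ler_norm _) hj.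
  by move: (harmonic i) (harmonic j) => a b; lra.
- move=> k; under eq_fun do rewrite -scalerAr toeplitzZl toeplitzZr mulrA ss.
  have h : (fun j => toeplitz (correlation mu T g) (E j) ('X^k * E j)) @ \oo
      --> s * (k == 0%N)%:R.
    rewrite eq_sym -[X in X @ _](_ : (fun j => toeplitz (correlation mu T g)
      ('X^0 * E j) ('X^k * E j)) = _); first exact: innovation_shift_cvg s_le E0 E_le _ _.
    by apply: boolp.funext => j; rewrite expr0 mul1r.
  have -> : kdelta k = s^-1 * (s * (k == 0%N)%:R) :> R.
    by rewrite mulKf// gt_eqF.
  by apply: cvgM; [exact: cvg_cst|exact: h].
by exists F; split=> //; exact: boolp.funext.
Qed.

(** The coefficients are 1 followed by a small negative geometric tail. In each autocorrelation of
    positive index, the product of the leading 1 with the tail is negative and outweighs the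
    positive products within the tail. *)
Lemma Lebesgue_strictly_under_recurrent : has_Lebesgue_component mu T ->
  exists f, strictly_under_recurrent mu T f.
Proof.
move=> /Lebesgue_componentP[f [f2 f0 fC]].
pose q : R := 2^-1.
pose a (k : nat) : R := if k is 0 then 1 else - q * q ^+ k.
have geo n : \sum_(k < n) (q ^+ 2) ^+ k.+1 = (1 - (q ^+ 2) ^+ n) / 3.
  elim: n => [|n IH]; first by rewrite big_ord0 expr0 subrr mul0r.
  rewrite big_ord_recr/= IH (exprS (q ^+ 2) n).
  by move: ((q ^+ 2) ^+ n) => x; rewrite /q; field.
have aa k l : a k.+1 * a l.+1 = q ^+ 2 * (q ^+ k.+1 * q ^+ l.+1).
  by rewrite /a; ring.
have aM n : \sum_(k < n) a k ^+ 2 <= 2.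
  case: n => [|n]; first by rewrite big_ord0.
  rewrite big_ord_recl/= expr1n.
  have -> : \sum_(i < n) (- q * q ^+ (bump 0 i)) ^+ 2 =
      q ^+ 2 * \sum_(i < n) (q ^+ 2) ^+ i.+1.
    rewrite mulr_sumr; apply: eq_bigr => i _.
    by rewrite /bump/= add1n exprMn sqrrN -!exprM mulnC.
  rewrite geo; have : 0 <= (q ^+ 2) ^+ n by rewrite exprn_ge0// sqr_ge0.
  by move: ((q ^+ 2) ^+ n) => x x0; rewrite /q; lra.
pose A n : {poly R} := \poly_(k < n) a k.
have autocorr m : (fun n => toeplitz kdelta (A n) ('X^(m.+1) * A n)) @ \oo -->
    - (5 / 12) * q ^+ m.+1.
  (* With [n + m + 2] coefficients the sequence and its shift by [m + 1] overlap in exactly [n + 1]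
     places: one for the leading 1 and [n] within the tail. *)
  rewrite -(cvg_shiftn m.+2).
  have -> : (fun n => toeplitz kdelta (A (n + m.+2)%N) ('X^(m.+1) * A (n + m.+2)%N)) =
      (fun n => - q * q ^+ m.+1 + q ^+ 2 * q ^+ m.+1 * ((1 - (q ^+ 2) ^+ n) / 3)).
    apply: boolp.funext => n; rewrite (toeplitz_kdelta _ (size_poly _ _)).
    rewrite (_ : (n + m.+2 = m.+1 + n.+1)%N); last by lia.
    rewrite big_split_ord/= big1 ?add0r => [|k _]; last by rewrite coefXnM ltn_ord mulr0.
    rewrite big_ord_recl/= -geo mulr_sumr; congr (_ + _).
      by rewrite coefXnM !coef_poly addn0 ltnn subnn /= addnS leq_addr mulr1.
    apply: eq_bigr => k _.
    have kn := ltn_ord k.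
    have h1 : (m.+1 + k.+1 < m.+1)%N = false by lia.
    have h2 : (m.+1 + k.+1 < m.+1 + n.+1)%N by lia.
    have h3 : (k.+1 < m.+1 + n.+1)%N by lia.
    rewrite coefXnM /bump leq0n add1n h1 addKn !coef_poly h2 h3 addSn aa -!exprM.
    have -> : (2 * k.+1 = k.+1 + k.+1)%N by lia.
    have -> : (m + k.+1).+1 = (m.+1 + k.+1)%N by [].
    by rewrite !exprD; ring.
  have -> : - (5 / 12) * q ^+ m.+1 =
      - q * q ^+ m.+1 + q ^+ 2 * q ^+ m.+1 * ((1 - 0) / 3).
    by rewrite /q; field.
  apply: cvgD; first exact: cvg_cst.
  apply: cvgM; first exact: cvg_cst.
  apply: cvgM; last exact: cvg_cst.
  apply: cvgB; first exact: cvg_cst.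
  apply: cvg_expr; rewrite ger0_norm ?sqr_ge0// /q; lra.
pose l := lim ((fun n => toeplitz kdelta (A n) (A n)) @ \oo).
have [||F [F2 F0 FC]] := @toeplitz_cauchy_limit _ _ _ mu T hT f A
  (fun m => if m is 0 then l else - (5 / 12) * q ^+ m) f2 f0.
- rewrite fC; exact: kdelta_series_cauchy aM.
- rewrite fC => -[|m]; last exact: autocorr.
  rewrite -[X in X @ _](_ : (fun n => toeplitz kdelta (A n) (A n)) = _).
    rewrite /l (_ : (fun n => toeplitz kdelta (A n) (A n)) =
      (fun n => \sum_(k < n) a k ^+ 2)); first exact: kdelta_series_cvg aM.
    by apply: boolp.funext => n; exact: kdelta_norm_poly.
  by apply: boolp.funext => n; rewrite expr0 mul1r.
have FCS n : correlation mu T F n.+1 < 0.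
  have : 0 < q ^+ n.+1 by rewrite exprn_gt0// invr_gt0.
  by rewrite FC; move: (q ^+ n.+1) => x x0; lra.
exists F; split=> //.
(* A constant of mean 0 vanishes, and then so does the correlation of index 1, which is negative. *)
- move=> [c Fc].
  have c0 : c = 0 by rewrite -(integral_ae_cst F2 Fc).
  have F00 : ip mu F F = 0 by apply/ip_eq0 => //; rewrite c0 in Fc.
  have := ip_CS F2 (L2_iter hT 1 F2); rewrite F00 mul0r.
  rewrite -/(correlation mu T F 1) le_eqVlt ltNge sqr_ge0 orbF sqrf_eq0.
  by rewrite (lt_eqF (FCS 0%N)).
- by case=> // n _; rewrite F0 expr0n.
Qed.

(* Only the correlations of positive index are prescribed, so the density may be
   replaced by its sum with [1], which is bounded away from [0]. *)
Lemma Lebesgue_realizes_nonneg_densities : has_Lebesgue_component mu T ->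
  realizes_nonneg_densities mu T.
Proof.
move=> /Lebesgue_componentP[f [f2 f0 fC]] phi [iphi phi0] phi_real.
(* Nonnegative at every point, while [phi] is so only almost everywhere. *)
pose w t := `|phi t|.
have iw : (@lebesgue_measure R).-integrable torus (EFin \o w).
  exact: integrable_norm iphi.
have wphi n : cosine_coef w n = cosine_coef phi n.
  rewrite /cosine_coef /Rintegral; congr fine; apply: ae_eq_integral.
  - exact: measurable_torus.
  - exact: measurable_int (cos_integrable n iw).
  - exact: measurable_int (cos_integrable n iphi).
  - apply: negligibleS phi0 => t /= h1 h2; apply: h1 => /h2 t0.
    by rewrite /w ger0_norm.
have [A [AC Ac]] := cosine_coef_factor iw (fun t _ => normr_ge0 (phi t)).
have [||F [F2 F0 FC]] := @toeplitz_cauchy_limit _ _ _ mu T hT f A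
  (fun m => 1 * kdelta m + cosine_coef w m) f2 f0.
- by rewrite fC.
- by rewrite fC.
exists F; split=> // n n0; rewrite FC /kdelta gtn_eqF// mulr0 add0r wphi.
(* The cosine coefficient is only the real part; the coefficient being real, nothing is lost. *)
rewrite -(RRe_real (phi_real n n0)); congr (_%:C)%C.
by apply: eq_Rintegral => t _; rewrite /= mul0r subr0.
Qed.

(** The density [1 - cos (2 pi t)] is nonnegative, has coefficient -1/2 at index 1 and 0 at every
    larger index. A function of mean 0 with these correlations is under-recurrent. *)
Lemma realizes_nonneg_densities_under_recurrent :
  realizes_nonneg_densities mu T -> exists f, under_recurrent mu T f.
Proof.
pose sinn n t : R := sin (2 * pi * n%:R * t).
have icos n : leb.-integrable torus (EFin \o cosn ^~ n) by exact: cosn_integrable.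
have isin n : leb.-integrable torus (EFin \o sinn n) by exact: sinn_integrable.
have split3 (f g h : R -> R) : leb.-integrable torus (EFin \o f) ->
    leb.-integrable torus (EFin \o g) -> leb.-integrable torus (EFin \o h) ->
    \int[leb]_(t in torus) (f t - 2^-1 * (g t + h t)) =
    \int[leb]_(t in torus) f t -
      2^-1 * (\int[leb]_(t in torus) g t + \int[leb]_(t in torus) h t).
  move=> iF ig ih; have mt := @measurable_torus R.
  have igh : leb.-integrable torus (EFin \o (fun t => g t + h t)).
    exact: (@integrableD _ _ _ leb torus mt (EFin \o g) (EFin \o h) ig ih).
  rewrite RintegralB ?RintegralZl ?RintegralD//.
  by have := @integrableZl _ _ _ leb torus mt 2^-1 _ igh.
pose phi t : R := 1 - cosn t 1.
have phi_cos n t : phi t * cosn t n.+1 =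
    cosn t n.+1 - 2^-1 * (cosn t n.+2 + cosn t n).
  have -> : cosn t n.+2 = cosn t n.+1 * cosn t 1 - sinn n.+1 t * sinn 1%N t.
    by rewrite /cosn /sinn -cosD; congr cos; rewrite -(natr1 n.+1); ring.
  have -> : cosn t n = cosn t n.+1 * cosn t 1 + sinn n.+1 t * sinn 1%N t.
    by rewrite /cosn /sinn -cosB; congr cos; rewrite -(natr1 n); ring.
  by rewrite /phi; field.
(* The sine integrals vanish, so the coefficients are real as [realizes_nonneg_densities]
   requires. *)
have phi_sin n t : phi t * sinn n.+1 t =
    sinn n.+1 t - 2^-1 * (sinn n.+2 t + sinn n t).
  have -> : sinn n.+2 t = sinn n.+1 t * cosn t 1 + cosn t n.+1 * sinn 1%N t.
    by rewrite /cosn /sinn -sinD; congr sin; rewrite -(natr1 n.+1); ring.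
  have -> : sinn n t = sinn n.+1 t * cosn t 1 - cosn t n.+1 * sinn 1%N t.
    by rewrite /cosn /sinn -sinB; congr sin; rewrite -(natr1 n); ring.
  by rewrite /phi; field.
have phiE n : fourier_coef phi n.+1 = (- (2^-1 * kdelta n))%:C%C.
  apply/eqP; rewrite eq_complex; apply/andP; split; apply/eqP => /=.
    rewrite (@eq_Rintegral _ _ _ leb torus (fun t => phi t * cosn t n.+1)); last first.
      by move=> t _; rewrite mul0r subr0.
    under eq_Rintegral do rewrite phi_cos.
    have kS m : kdelta m.+1 = 0 :> R by [].
    by rewrite split3// !integral_cosn_torus !kS !add0r.
  rewrite (@eq_Rintegral _ _ _ leb torus (fun t => phi t * sinn n.+1 t)); last first.
    by move=> t _; rewrite mul0r addr0.
  under eq_Rintegral do rewrite phi_sin.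
  by rewrite split3// !integral_sinn_torus addr0 mulr0 subr0.
have phi_nonneg : nonneg_L1_torus phi.
  split; last by apply: aeW => t _; rewrite subr_ge0 cos_le1.
  exact: (@integrableB _ _ _ leb torus (@measurable_torus R) (EFin \o cst 1)
    (EFin \o cosn ^~ 1%N) (integrable_torus_cst 1) (icos 1%N)).
move=> /(_ phi phi_nonneg)[|g [g2 g0 gC]].
  by move=> [|n]// _; rewrite phiE complex_real.
have {}gC n : correlation mu T g n.+1 = - (2^-1 * kdelta n).
  by have := gC n.+1 isT; rewrite phiE => -[].
exists g; split=> //.
(* A constant of mean 0 would have correlation 0 at index 1 instead of -1/2. *)
- move=> [c gc]; have c0 : c = 0 by rewrite -(integral_ae_cst g2 gc).
  have g00 : ip mu g g = 0 by apply/ip_eq0 => //; rewrite c0 in gc.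
  have := ip_CS g2 (L2_iter hT 1 g2); rewrite g00 mul0r.
  rewrite -[ip mu g _]/(correlation mu T g 1) (gC 0%N) mulr1 sqrrN.
  by rewrite leNgt exprn_gt0// invr_gt0.
- by case=> // n _; rewrite g0 expr0n/= gC oppr_le0 mulr_ge0 ?ler0n ?invr_ge0.
Qed.

End implications.

Theorem theorem2p5 (d : measure_display) (X : measurableType d) (R : realType)
    (mu : probability X R) (T : X -> X) (hT : measure_preserving mu T) :
  [<-> exists f : X -> R, under_recurrent mu T f;
       exists f : X -> R, strictly_under_recurrent mu T f;
       has_Lebesgue_component mu T;
       realizes_nonneg_densities mu T].
Proof.
tfae.
(* The first implication of the cycle already passes through a Lebesgue component. *)
- move=> [f /(under_recurrent_Lebesgue hT)].
  exact: Lebesgue_strictly_under_recurrent.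
- move=> [f [f2 fnc fC]]; apply: (under_recurrent_Lebesgue hT (f := f)).
  by split=> // n n0; exact/ltW/fC.
- exact: Lebesgue_realizes_nonneg_densities.
- exact: realizes_nonneg_densities_under_recurrent.
Qed.
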